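(* Assume: (I) $\sigma(B)\subset\{0\}\cup[\delta,\infty)$ for some $\delta>0$; (II) $\dim\operatorname{Ker}B<\infty$; (III) $J\mathcal K\subset\mathcal V$; (IV) $H^*=H$. Let $X\in\mathcal W:=\{X\in\mathcal V:\Lambda X\in D(H)\}$. Then $$X=\int_{\mathbb R}dF(\omega)X=X_\varepsilon+X_0+X_a,\qquad AX=-i\int_{\mathbb R}\omega\,dF(\omega)X=AX_\varepsilon+AX_0+AX_a,$$ where $$X_\varepsilon:=\int_{|\omega|\ge\varepsilon}\Bigl[\Lambda_+^{-1}+\frac{iP}{\omega}\Bigr]dE(\omega)\Lambda X,\qquad AX_\varepsilon=-i\int_{|\omega|\ge\varepsilon}\bigl[\omega\Lambda_+^{-1}+iP\bigr]dE(\omega)\Lambda X,$$ $$X_0:=\Bigl[\Pi_{\mathcal K}-iP\int_{|\omega|\ge\varepsilon}\frac{dE(\omega)}{\omega}\Lambda\Bigr]X,\qquad AX_0=0,$$ $$X_a:=\Lambda_+^{-1}\Pi_0\Lambda X,\qquad AX_a=P\Pi_0\Lambda X.$$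
   Context: $\mathcal X$ is a complex Hilbert space; $J:\mathcal X\to\mathcal X$ is bounded with $J^*=-J$, $J^2=-1$; $B$ is a densely defined selfadjoint nonnegative operator in $\mathcal X$; $A=JB$ with domain $D(B)$. $\Lambda:=B^{1/2}\ge0$; $\mathcal V$ is the domain of $\Lambda$ with norm $\|X\|_{\mathcal V}=\|\Lambda X\|_{\mathcal X}+\|X\|_{\mathcal X}$. $\mathcal K:=\operatorname{Ker}\Lambda=\operatorname{Ker}B$, $\mathcal R:=\operatorname{Ran}\Lambda=\mathcal K^\perp$. $\Lambda_+:=\Lambda|_{\mathcal R\cap\mathcal V}:\mathcal R\cap\mathcal V\to\mathcal R$, which under (I) has a bounded inverse $\Lambda_+^{-1}:\mathcal R\to\mathcal V$. $\Pi_{\mathcal K}$ is the orthogonal projection onto $\mathcal K$. $P:=\Pi_{\mathcal K}J\Lambda$, which under (II), (III) extends to a bounded operator $\mathcal X\to\mathcal V$, also denoted $P$. $H:=\Lambda iJ\Lambda$ with domain $D(H)=\{Z\in\mathcal V: J\Lambda Z\in\mathcal V\}$. Under (I)–(IV), $\sigma(H)\subset(-\infty,-\varepsilon]\cup\{0\}\cup[\varepsilon,\infty)$ for some $\varepsilon>0$, which is fixed. $dE(\omega)$ is the spectral family of $H$; $\Pi_0$ is the orthogonal projection onto $\operatorname{Ker}H\cap\mathcal R$. $dF(\omega)$ denotes the operator-valued distribution $$dF(\omega)=\Bigl[\Lambda_+^{-1}+\frac{iP}{\omega}\Bigr]\chi_\varepsilon(\omega)dE(\omega)\Lambda+\Bigl[\Pi_{\mathcal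 K}-iP\int_{|\omega'|\ge\varepsilon}\frac{dE(\omega')}{\omega'}\Lambda\Bigr]\delta(\omega)d\omega+\Lambda_+^{-1}\Pi_0\Lambda\,\delta(\omega)d\omega-iP\Pi_0\Lambda\,\delta'(\omega)d\omega,$$ where $\chi_\varepsilon$ is the indicator of $\{|\omega|\ge\varepsilon\}$ and $\delta$ the Dirac delta ($\int\phi\,\delta'\,d\omega=-\phi'(0)$). *)

(* Defs.v *)
From HB Require Import structures.
From mathcomp Require Import all_boot all_order all_algebra sesquilinear.
From mathcomp Require Import complex.
From mathcomp Require Import all_classical all_reals all_analysis.
Import Order.TTheory GRing.Theory Num.Theory.
Import numFieldNormedType.Exports.

Set Implicit Arguments.
Unset Strict Implicit.
Unset Printing Implicit Defensive.

Local Open Scope classical_set_scope.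
Local Open Scope ring_scope.

(* Partially defined operators; the values of [op_fun T] outside [dom T] are
   never meaningful. *)
Record operator (X : Type) : Type := Operator {
  dom : set X ;
  op_fun :> X -> X }.

Section operators.
Variables (R : realType) (X : completeNormedModType R[i]).
Implicit Types (S T : operator X) (x y z : X).

Definition everywhere (f : X -> X) : operator X := Operator setT f.

Definition op_comp S T : operator X :=
  Operator [set x | dom T x /\ dom S (T x)] (fun x => S (T x)).

Definition op_eq S T : Prop :=
  dom S = dom T /\ (forall x, dom S x -> S x = T x).

Definition op_linear T : Prop :=
  dom T 0 /\
  forall (a : R[i]) x y, dom T x -> dom T y ->
    dom T (a *: x + y) /\ T (a *: x + y) = a *: T x + T y.

Definition op_ker T : set X := [set x | dom T x /\ T x = 0].

Definition op_range T : set X := [set T x | x in dom T].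

Definition resolvent_set T : set R[i] :=
  [set z | exists S : {linear X -> X},
    [/\ continuous S,
        forall y, dom T (S y) /\ T (S y) - z *: S y = y &
        forall x, dom T x -> S (T x - z *: x) = x]].

Definition spectrum T : set R[i] := ~` resolvent_set T.

Definition finite_dimensional (S : set X) : Prop :=
  exists (n : nat) (e : 'I_n -> X),
    S = range (fun c : 'I_n -> R[i] => \sum_(i < n) c i *: e i).

Definition graph_norm T x : R[i] := `|T x| + `|x|.

(* f is bounded from X to the domain of T with its graph norm. *)
Definition bounded_to_dom T (f : X -> X) : Prop :=
  exists M : R, forall x, dom T (f x) /\ graph_norm T (f x) <= M%:C%C * `|x|.

End operators.

Section hilbert.
Variables (R : realType) (X : completeNormedModType R[i]).
(* [dot] is linear in its first argument and antilinear in the second. *)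
Variable dot : {dot X for Num.conj}.
Implicit Types (T : operator X) (x y z : X).

Definition dot_induces_norm : Prop := forall x, `|x| ^+ 2 = dot x x.

(* Meaningful for densely defined T, where z is determined by y. *)
Definition adjoint T : operator X :=
  let is_adj y z := forall x, dom T x -> dot (T x) y = dot x z in
  Operator [set y | exists z, is_adj y z] (fun y => xget 0 [set z | is_adj y z]).

Definition selfadjoint T : Prop :=
  [/\ op_linear T, closure (dom T) = setT & op_eq (adjoint T) T].

Definition nonneg_op T : Prop := forall x, dom T x -> 0 <= dot (T x) x.

(* Meaningful for closed subspaces S. *)
Definition oproj (S : set X) x : X :=
  xget 0 [set y | S y /\ forall z, S z -> dot (x - y) z = 0].

Definition is_sqrt_op (B L : operator X) : Prop :=
  [/\ selfadjoint L, nonneg_op L & op_eq (op_comp L L) B].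

Definition orthogonal_projection (f : X -> X) : Prop :=
  [/\ linear f, forall x, f (f x) = f x & forall x y, dot (f x) y = dot x (f y)].

(* Projection-valued measures on the Borel sets of R; the right-continuous
   family of projections is lambda |-> E `]-oo, lambda]. *)
Definition projection_measure (E : set R -> X -> X) : Prop :=
  [/\ forall A, measurable A -> orthogonal_projection (E A),
      forall x, E setT x = x &
      forall (F : nat -> set R) x,
        (forall n, measurable (F n)) -> trivIset setT F ->
        (fun n => \sum_(i < n) E (F i) x) @ \oo --> E (\bigcup_n F n) x].

End hilbert.

(* The integral of an operator-valued function k against dE(w) y over a Borel
   set D, as a norm limit of the Riemann-Stieltjes sums
   \sum_i k(t_i) E(A_i) y, first over D `&` `[a, b], then as a -> -oo and
   b -> +oo independently.  Parts of partitions are subsets of D, so atoms of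
   E at boundary points of D are integrated correctly. *)
Section spectral_integral.
Variables (R : realType) (X : completeNormedModType R[i]).
Variable E : set R -> X -> X.
Implicit Types (D : set R) (k : R -> X -> X) (x y z : X).

Definition tagged_partition D (eta : R) n (A : 'I_n -> set R) (t : 'I_n -> R) :=
  [/\ forall i, measurable (A i),
      trivIset setT A,
      \bigcup_i A i = D,
      forall i, A i (t i) &
      forall i r s, A i r -> A i s -> `|r - s| <= eta].

Definition is_RSint D k y z : Prop :=
  forall e : R, 0 < e -> exists2 eta : R, 0 < eta &
    forall n (A : 'I_n -> set R) (t : 'I_n -> R), tagged_partition D eta A t ->
      `|\sum_(i < n) k (t i) (E (A i) y) - z| < e%:C%C.

Definition is_sint D k y z : Prop :=
  exists I : R -> R -> X,
    (forall a b, is_RSint (D `&` `[a, b]) k y (I a b)) /\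
    (fun ab => I ab.1 ab.2) @ filter_prod (ninfty_nbhs R) (pinfty_nbhs R) --> z.

Definition ex_sint D k y : Prop := exists z, is_sint D k y z.

Definition sint D k y : X := xget 0 [set z | is_sint D k y z].

End spectral_integral.

(* E is the spectral family of T: T y = \int w dE(w) y, the domain of T being
   the set of all y for which this integral converges. *)
Definition spectral_family (R : realType) (X : completeNormedModType R[i])
    (dot : {dot X for Num.conj}) (T : operator X) (E : set R -> X -> X) : Prop :=
  projection_measure dot E /\
  forall y z, (dom T y /\ T y = z) <->
              is_sint E setT (fun w v => w%:C%C *: v) y z.

(* Distributions are evaluated on real test functions; \int phi delta' = - phi'(0). *)
Definition delta (R : realType) (phi : R -> R) : R := phi 0.
Definition delta' (R : realType) (phi : R -> R) : R := - derive1 phi 0.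

Section problem.
Variables (R : realType) (X : completeNormedModType R[i]).
Variable dot : {dot X for Num.conj}.
Variable J : X -> X.
Variables B L : operator X.

Definition A_op : operator X := Operator (dom B) (fun x => J (B x)).

Definition H_op : operator X :=
  Operator [set z | dom L z /\ dom L (J (L z))] (fun z => L ('i%C *: J (L z))).

Definition W_space : set X := [set x | dom L x /\ dom H_op (L x)].

Definition Pi_K : X -> X := oproj dot (op_ker L).

Definition Pi_0 : X -> X := oproj dot (op_ker H_op `&` op_range L).

(* Meaningful on op_range L only. *)
Definition Lplus_inv (y : X) : X :=
  xget 0 [set x | [/\ op_range L x, dom L x & L x = y]].

(* The bounded extension of Pi_K J L from dom L to X. *)
Definition P_op : X -> X :=
  xget (fun=> 0) [set Q : X -> X |
    [/\ linear Q, bounded_to_dom L Q &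
        forall x, dom L x -> Q x = Pi_K (J (L x))]].

Variables (E : set R -> X -> X) (eps : R).

Definition outer : set R := [set w | eps <= `|w|].

(* \int_{|w| >= eps} dE(w)/w y *)
Definition Hinv_int (y : X) : X := sint E outer (fun w v => (w%:C%C)^-1 *: v) y.

(* (L_+^-1 + i P / w) v *)
Definition dF_kernel (w : R) (v : X) : X :=
  Lplus_inv v + ('i%C / w%:C%C) *: P_op v.

(* The value of the distribution dF x at phi; the factor chi_eps(w) is the
   restriction of the domain of integration to [outer]. *)
Definition dF (phi : R -> R) (x : X) : X :=
  sint E outer (fun w v => (phi w)%:C%C *: dF_kernel w v) (L x)
  + (delta phi)%:C%C *: (Pi_K x - 'i%C *: P_op (Hinv_int (L x)))
  + (delta phi)%:C%C *: Lplus_inv (Pi_0 (L x))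
  - (delta' phi)%:C%C *: ('i%C *: P_op (Pi_0 (L x))).

(* The integrals in dF phi x converge. *)
Definition dF_defined (phi : R -> R) (x : X) : Prop :=
  ex_sint E outer (fun w v => (phi w)%:C%C *: dF_kernel w v) (L x) /\
  ex_sint E outer (fun w v => (w%:C%C)^-1 *: v) (L x).

End problem.

(* Main.v *)
(** Put [y := L x].  The spectral family of [H] kills the gap [0 < |w| < eps],
    so [y] splits into [E {0} y], in the kernel of [H], and [E D y] with
    [D := {|w| >= eps}].  As [L] is invertible off its kernel, [x] is recovered
    as [Pi_K x + Lplus_inv (E D y) + Lplus_inv (E {0} y)], the terms containing
    [P] cancelling out, and [Lplus_inv (H v) = i (1 - Pi_K) J L v] gives the
    images under [A].

    No spectral theorem is used.  For [B], the resolvent at the middle [l] of the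
    gap has norm at most [1 / l], whence [L] is bounded below on the complement
    of its kernel.  For [H], the only fact needed is that
    [E A (H g - s g)] has norm at most [eta |E A g|] whenever [A] lies within
    [eta] of [s]; it bounds the error of all Riemann sums, since [E D y = H g]
    for some [g] turns the sums of [1 / w] against [dE y] into sums against
    [dE (H g)].  The integrals involving [Lplus_inv] and [P] are images of these
    under bounded operators. *)
Require Import Defs.
From HB Require Import structures.
From mathcomp Require Import all_boot all_order all_algebra sesquilinear.
From mathcomp Require Import complex.
From mathcomp Require Import all_classical all_reals all_analysis.
From mathcomp Require Import ring lra.
Import Order.TTheory GRing.Theory Num.Theory.
Import numFieldNormedType.Exports.
Set Implicit Arguments.
Unset Strict Implicit.
Unset Printing Implicit Defensive.
Local Open Scope classical_set_scope.
Local Open Scope ring_scope.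

(** * Hilbert space geometry *)

(** The spectrum is defined by bounded inverses, whereas [E] is accessible only through countable
    additivity and Riemann-Stieltjes sums. The two are confronted on vectors [E A g] with [A] close
    to a point [mu] of the gap: localization makes [H - mu] small there, the resolvent at [mu]
    bounds it from below, so [E A g] must vanish. [Lplus_inv] has a meaning on [op_range L] only.
    Since [op_ker L] lies in [op_ker H], every piece [E A y] with [A] inside [D] stays in that
    range, where [Lplus_inv] agrees with a bounded linear map. [P] is bounded because (II) and (III)
    give it finite rank: [<P x, f> = - <x, L (J f)>] for [f] in [op_ker L]. The [P] terms cancel
    because the integral of [1 / w] against [dE y] over [D] is the vector [g] with [H g = E D y] and
    [E D g = g]; it enters [X_eps] as [i P g] and [X_0] as [- i P g]. *)

Section real_norm.
Variables (R : realType) (X : completeNormedModType R[i]).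
Implicit Types (x y z : X).

(** The norm of [X] has values in [R[i]]; a real-valued copy makes infima and real arithmetic
    tactics available. *)
Definition nm x : R := complex.Re `|x|.

Lemma nmE x : `|x| = (nm x)%:C%C.
Proof. by rewrite /nm RRe_real // normr_real. Qed.

Lemma nm_ge0 x : 0 <= nm x.
Proof. by rewrite -ler0c -nmE. Qed.

Lemma nm0 : nm 0 = 0.
Proof. by apply: complexI; rewrite -nmE normr0. Qed.

Lemma nm_eq0 x : nm x = 0 -> x = 0.
Proof. by move=> h; apply/normr0_eq0; rewrite nmE h. Qed.

Lemma nmN x : nm (- x) = nm x.
Proof. by rewrite /nm normrN. Qed.

Lemma nmD x y : nm (x + y) <= nm x + nm y.
Proof. by rewrite -lecR rmorphD /= -!nmE ler_normD. Qed.

Lemma nmBC x y : nm (x - y) = nm (y - x).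
Proof. by rewrite -nmN opprB. Qed.

Lemma nmB x y : nm (x - y) <= nm x + nm y.
Proof. by rewrite -(nmN y) nmD. Qed.

Lemma nm_tri y x z : nm (x - z) <= nm (x - y) + nm (y - z).
Proof. by have := nmD (x - y) (y - z); rewrite addrA subrK. Qed.

Lemma nmZ (t : R) x : nm (t%:C%C *: x) = `|t| * nm x.
Proof.
apply: complexI; rewrite -nmE normrZ rmorphM /= -nmE; congr (_ * _).
by rewrite normc_def /= expr0n addr0 sqrtr_sqr.
Qed.

Lemma nmZc (a : R[i]) x : nm (a *: x) = complex.Re `|a| * nm x.
Proof.
have ha : (complex.Re `|a|)%:C%C = `|a| by rewrite RRe_real // normr_real.
by apply: complexI; rewrite -nmE normrZ rmorphM /= -nmE; congr (_ * _).
Qed.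

Lemma nmZi x : nm ('i%C *: x) = nm x.
Proof. 
by apply: complexI; rewrite -!nmE normrZ normc_def /= expr0n expr1n add0r sqrtr1 mul1r.
Qed.

Lemma cvg_nm (T : Type) (F : set_system T) {FF : Filter F} (f : T -> X) l :
  f @ F --> l <-> forall e : R, 0 < e -> \forall t \near F, nm (l - f t) < e.
Proof.
split => [/cvgrPdist_lt h e e0|h].
  have := h e%:C%C; rewrite ltcR => /(_ e0); apply: filterS => t.
  by rewrite nmE ltcR.
apply/cvgrPdist_lt => e; rewrite ltcE /= => /andP[/eqP ei er].
move: (h _ er); apply: filterS => t; rewrite nmE ltcE /= => ->.
by rewrite ei eqxx.
Qed.

Lemma cauchy_nm (u : nat -> X) :
  (forall e : R, 0 < e -> exists N, forall m n, (N <= m)%N -> (N <= n)%N ->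
    nm (u m - u n) < e) ->
  exists l, forall e : R, 0 < e -> exists N, forall n, (N <= n)%N -> nm (l - u n) < e.
Proof.
move=> h; have /cauchy_cvgP : cauchy (u @ \oo).
  apply: cauchy_exP => e; rewrite ltcE /= => /andP[/eqP ei er].
  have [N hN] := h _ er; exists (u N); exists N => // n /= Nn.
  rewrite -ball_normE /= nmE ltcE /= ei eqxx /=; exact: hN.
move=> c; exists (lim (u @ \oo)) => e e0.
have /cvg_nm/(_ _ e0) [N _ hN] : u @ \oo --> lim (u @ \oo) by exact: c.
by exists N => n Nn; exact: hN.
Qed.

Lemma nm_small x : (forall e : R, 0 < e -> nm x <= e) -> x = 0.
Proof.
move=> h; apply: nm_eq0; apply/eqP; rewrite eq_le nm_ge0 andbT.
by apply/ler_addgt0Pr => e /h; rewrite add0r.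
Qed.

Definition linsub (S : set X) :=
  S 0 /\ forall (a : R[i]) x y, S x -> S y -> S (a *: x + y).

Definition nmclosed (S : set X) :=
  forall x, (forall e : R, 0 < e -> exists2 y, S y & nm (x - y) < e) -> S x.

Section subspace_theory.
Variable S : set X.
Hypothesis hS : linsub S.
Lemma linsubZ a x : S x -> S (a *: x).
Proof. by move=> Sx; rewrite -[_ *: _]addr0; apply: hS.2 => //; exact: hS.1. Qed.
Lemma linsubD x y : S x -> S y -> S (x + y).
Proof. by move=> Sx Sy; rewrite -[x]scale1r; exact: hS.2. Qed.
Lemma linsubN x : S x -> S (- x).
Proof. by move=> Sx; rewrite -scaleN1r; exact: linsubZ. Qed.
Lemma linsubB x y : S x -> S y -> S (x - y).
Proof. by move=> Sx Sy; apply: linsubD => //; exact: linsubN. Qed.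
End subspace_theory.

Lemma continuous_nm (f : {linear X -> X}) : continuous f ->
  exists2 M : R, 0 < M & forall x, nm (f x) <= M * nm x.
Proof.
move=> /(_ 0)/continuous_linear_bounded/linear_boundedP [M [Mr h]].
have hR : (complex.Re `|M|)%:C%C = `|M| by rewrite RRe_real // normr_real.
have hM : `|M| + 1 = (complex.Re `|M| + 1)%:C%C.
  by rewrite -{1}hR; apply/eqP; rewrite eq_complex /= addr0 !eqxx.
have Mge : 0 <= complex.Re `|M| by rewrite -ler0c hR.
(* Boundedness near infinity gives the estimate only for constants strictly above [M]. *)
exists (complex.Re `|M| + 1); first by lra.
move=> x; have := h (`|M| + 1); rewrite hM.
have lt : M < (complex.Re `|M| + 1)%:C%C.
  by rewrite -hM (le_lt_trans (real_ler_norm Mr)) // ltrDl.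
by move=> /(_ lt x); rewrite !nmE -rmorphM lecR.
Qed.

Lemma closure_nm (S : set X) : closure S = setT ->
  forall x (e : R), 0 < e -> exists2 y, S y & nm (x - y) < e.
Proof.
move=> cS x e e0; have : closure S x by rewrite cS.
move=> /(_ (ball x e%:C%C)) [|y [Sy]].
  by apply: nbhsx_ballx; rewrite ltcR.
by rewrite -ball_normE /= nmE ltcR => ?; exists y.
Qed.

End real_norm.

(** * Cauchy-Schwarz inequality and projection theorem *)

Section inner_product.
Variables (R : realType) (X : completeNormedModType R[i]).
Variable dot : {dot X for Num.conj}.
Hypothesis hdot : dot_induces_norm dot.
Implicit Types (x y z : X).

(** All estimates use this real inner product. On complex subspaces, orthogonality for [rd] and for
    [dot] coincide. *)
Definition rd x y : R := complex.Re (dot x y).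

Lemma dotC x y : dot x y = (dot y x)^*.
Proof. by rewrite hermC expr0 mul1r. Qed.

Lemma dotZl a x y : dot (a *: x) y = a * dot x y.
Proof. by rewrite linearZl_LR. Qed.

Lemma dotZr a x y : dot x (a *: y) = a^* * dot x y.
Proof. by rewrite linearZr_LR. Qed.

Lemma dotDl x y z : dot (x + y) z = dot x z + dot y z.
Proof. exact: linearDl. Qed.

Lemma dotBl x y z : dot (x - y) z = dot x z - dot y z.
Proof. exact: linearBl. Qed.

Lemma dotBr x y z : dot x (y - z) = dot x y - dot x z.
Proof. exact: linearBr. Qed.

Lemma rdC x y : rd x y = rd y x.
Proof. by rewrite /rd dotC; case: (dot y x). Qed.

Lemma rdDl x y z : rd (x + y) z = rd x z + rd y z.
Proof. by rewrite /rd linearDl raddfD. Qed.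
Lemma rdDr x y z : rd x (y + z) = rd x y + rd x z.
Proof. by rewrite !(rdC x) rdDl. Qed.
Lemma rdNl x y : rd (- x) y = - rd x y.
Proof. by rewrite /rd linearNl raddfN. Qed.
Lemma rdNr x y : rd x (- y) = - rd x y.
Proof. by rewrite !(rdC x) rdNl. Qed.
Lemma rdBl x y z : rd (x - y) z = rd x z - rd y z.
Proof. by rewrite rdDl rdNl. Qed.
Lemma rdBr x y z : rd x (y - z) = rd x y - rd x z.
Proof. by rewrite rdDr rdNr. Qed.
Lemma rd0l x : rd 0 x = 0.
Proof. by rewrite /rd linear0l. Qed.
Lemma rd0r x : rd x 0 = 0.
Proof. by rewrite rdC rd0l. Qed.
Lemma rdZl (t : R) x y : rd (t%:C%C *: x) y = t * rd x y.
Proof. by rewrite /rd dotZl; case: (dot x y) => a b /=; rewrite mul0r subr0. Qed.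
Lemma rdZr (t : R) x y : rd x (t%:C%C *: y) = t * rd x y.
Proof. by rewrite !(rdC x) rdZl. Qed.

Lemma dotxx x : dot x x = (nm x ^+ 2)%:C%C.
Proof. by rewrite -hdot nmE rmorphXn. Qed.

Lemma rdxx x : rd x x = nm x ^+ 2.
Proof. by rewrite /rd dotxx. Qed.

Lemma nm2D x y : nm (x + y) ^+ 2 = nm x ^+ 2 + 2 * rd x y + nm y ^+ 2.
Proof. by rewrite -!rdxx !rdDl !rdDr (rdC y x); ring. Qed.

Lemma nm2B x y : nm (x - y) ^+ 2 = nm x ^+ 2 - 2 * rd x y + nm y ^+ 2.
Proof. by rewrite nm2D rdNr nmN; ring. Qed.

Lemma rdi x y : rd x ('i%C *: y) = complex.Im (dot x y).
Proof.
rewrite /rd dotZr; case: (dot x y) => a b /=.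
by rewrite mul0r mulN1r opprK add0r.
Qed.

Lemma dot0P x y : rd x y = 0 -> rd x ('i%C *: y) = 0 -> dot x y = 0.
Proof.
rewrite rdi /rd; case: (dot x y) => a b /= -> ->. by [].
Qed.

(** Stated for degenerate forms because it serves both [rd] and the form [<C x, y>] of
    [sqrt_lower_bound], which vanishes on the kernel. *)
Lemma nonneg_form_CS (q : X -> X -> R) :
  (forall x y z, q (x + y) z = q x z + q y z) ->
  (forall x y, q x y = q y x) ->
  (forall t x y, q (t%:C%C *: x) y = t * q x y) ->
  (forall x, 0 <= q x x) ->
  forall x y, q x y ^+ 2 <= q x x * q y y.
Proof.
move=> qD qC qZ q0 x y.
have key s t : 0 <= s ^+ 2 * q x x + 2 * s * t * q x y + t ^+ 2 * q y y.
  have := q0 (s%:C%C *: x + t%:C%C *: y).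
  rewrite qD (qC (s%:C%C *: x)) (qC (t%:C%C *: y)) !qD.
  rewrite !qZ (qC x (s%:C%C *: x)) (qC x (t%:C%C *: y)).
  rewrite (qC y (s%:C%C *: x)) (qC y (t%:C%C *: y)) !qZ (qC y x).
  by congr (_ <= _); ring.
have [y0|y0] := eqVneq (q y y) 0.
  rewrite y0 mulr0.
  (* When [q y y = 0] the quadratic expression is affine in [t]; this choice turns it into
     [- (q x x + 2) * q x y ^+ 2], which forces [q x y = 0]. *)
  have := key (q x y) (- (q x x + 1)); rewrite y0.
  have := q0 x; set a := q x x; set b := q x y => a0.
  rewrite mulr0 addr0 => h; have : 0 <= - (a + 2) * b ^+ 2.
    by apply: le_trans h _; rewrite le_eqVlt; apply/orP; left; apply/eqP; ring.
  have b2 : 0 <= b ^+ 2 by rewrite sqr_ge0.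
  nra.
have yp : 0 < q y y by rewrite lt_neqAle eq_sym y0 q0.
have := key (q y y) (- q x y); set a := q x x; set b := q x y; set c := q y y => h.
have {}h : 0 <= c * (a * c - b ^+ 2).
  by apply: le_trans h _; rewrite le_eqVlt; apply/orP; left; apply/eqP; ring.
by move: h; rewrite pmulr_rge0 // subr_ge0.
Qed.

Lemma rd_CS x y : `|rd x y| <= nm x * nm y.
Proof.
rewrite -(ler_pXn2r (n := 2)) ?nnegrE ?mulr_ge0 ?nm_ge0 //.
rewrite real_normK ?num_real // exprMn -!rdxx.
apply: nonneg_form_CS.
- by move=> *; rewrite rdDl.
- exact: rdC.
- by move=> *; rewrite rdZl.
- by move=> z; rewrite rdxx sqr_ge0.
Qed.

Lemma rd_le x y : rd x y <= nm x * nm y.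
Proof. exact: le_trans (ler_norm _) (rd_CS x y). Qed.

(** A complex subspace contains ['i y] along with [y], and testing against ['i y] yields the
    imaginary part. *)
Lemma dot_eq0 z (S : set X) : linsub S ->
  (forall y, S y -> rd z y = 0) -> forall y, S y -> dot z y = 0.
Proof. by move=> hS h y Sy; apply: dot0P; apply: h => //; exact: linsubZ. Qed.

Definition perp (S : set X) : set X := [set z | forall y, S y -> rd z y = 0].

Lemma perp_closed (S : set X) : nmclosed (perp S).
Proof.
move=> x h y Sy; apply/eqP; rewrite -normr_le0; apply/ler_addgt0Pr => e e0.
have y0 := nm_ge0 y.
have [|z Sz xz] := h (e / (nm y + 1)); first by rewrite divr_gt0 //; lra.
have -> : rd x y = rd (x - z) y by rewrite rdBl Sz // subr0.
rewrite add0r (le_trans (rd_CS _ _)) //.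
move: xz; rewrite ltr_pdivlMr; last lra.
have := nm_ge0 (x - z); nra.
Qed.

Lemma perp_linsub (S : set X) : linsub S -> linsub (perp S).
Proof.
move=> hS; split=> [y _|a x y Sx Sy z Sz]; first by rewrite rd0l.
rewrite rdDl Sy // addr0.
have : dot x z = 0 by exact: dot_eq0 Sz.
by rewrite /rd dotZl => ->; rewrite mulr0.
Qed.

Lemma perp_cap (S : set X) x : S x -> perp S x -> x = 0.
Proof.
move=> Sx /(_ x Sx); rewrite rdxx => /eqP; rewrite expf_eq0 /= => /eqP.
exact: nm_eq0.
Qed.

Lemma projection_theorem (S : set X) : linsub S -> nmclosed S ->
  forall x, exists2 y, S y & perp S (x - y).
Proof.
move=> hS cS x.
pose Q := [set nm (x - y) | y in S].
have Q0 : Q !=set0 by exists (nm (x - 0)), 0 => //; exact: hS.1.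
have lQ : lbound Q 0 by move=> _ [y _ <-]; exact: nm_ge0.
have hQ : has_inf Q by split=> //; exists 0.
pose d := inf Q.
have d0 : 0 <= d by exact: lb_le_inf.
have dle y : S y -> d <= nm (x - y) by move=> Sy; apply: (inf_lbound hQ.2); exists y.
have ex (n : nat) : exists y, S y /\ nm (x - y) < d + n.+1%:R^-1.
  have e0 : 0 < n.+1%:R^-1 :> R by rewrite invr_gt0 ltr0n.
  have [_ [y Sy <-] h] := inf_adherent e0 hQ.
  by exists y.
have [u hu] := choice ex.
have Su n : S (u n) := (hu n).1.
have du n := (hu n).2.
(* Parallelogram law: the midpoint [h] of [u m] and [u n] lies in [S], hence has distance at least
   [d] from [x]. *)
have par m n : nm (u m - u n) ^+ 2 <=
    2 * nm (x - u m) ^+ 2 + 2 * nm (x - u n) ^+ 2 - 4 * d ^+ 2.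
  pose h : X := (2^-1 : R)%:C%C *: (u m + u n).
  have Sh : S h by apply: linsubZ => //; exact: linsubD.
  have e1 : (x - u m) + (x - u n) = (2 : R)%:C%C *: (x - h).
    rewrite scalerBr /h scalerA -rmorphM /= mulfV // scale1r.
    rewrite rmorphMn /= rmorph1 scaler_nat mulr2n opprD !addrA.
    by rewrite -!addrA; congr (_ + _); rewrite addrCA.
  have e2 : u m - u n = (x - u n) - (x - u m).
    by rewrite opprB [RHS]addrC addrA subrK.
  have := nm2D (x - u m) (x - u n); rewrite e1 nmZ exprMn real_normK ?num_real //.
  rewrite e2 (nm2B (x - u n) (x - u m)) (rdC (x - u n)).
  have : d ^+ 2 <= nm (x - h) ^+ 2 by rewrite ler_pXn2r ?nnegrE ?nm_ge0 ?dle.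
  lra.
have cau : forall e : R, 0 < e -> exists N, forall m n, (N <= m)%N -> (N <= n)%N ->
    nm (u m - u n) < e.
  move=> e e0.
  (* By [par] the squared distance is below [4 * ((d + s) ^+ 2 - d ^+ 2)], which is at most
     [s * (8 * d + 4)] for [s <= 1]. *)
  pose s := Num.min 1 (e ^+ 2 / (8 * d + 5)).
  have s0 : 0 < s.
    rewrite lt_min ltr01 /= divr_gt0 ?exprn_gt0 //; lra.
  have s1 : s <= 1 by rewrite ge_min lexx.
  have s2 : s * (8 * d + 5) <= e ^+ 2.
    by rewrite -ler_pdivlMr ?ge_min ?lexx ?orbT //; lra.
  have [N _ hN] := near_infty_natSinv_lt (PosNum s0).
  exists N => m n Nm Nn.
  have dm : nm (x - u m) < d + s.
    by apply: lt_le_trans (du m) _; rewrite lerD2l ltW //; exact: (hN m).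
  have dn : nm (x - u n) < d + s.
    by apply: lt_le_trans (du n) _; rewrite lerD2l ltW //; exact: (hN n).
  rewrite -(ltr_pXn2r (n := 2)) ?nnegrE ?nm_ge0 ?ltW //.
  apply: le_lt_trans (par m n) _.
  have sq a : 0 <= a -> a < d + s -> a ^+ 2 < (d + s) ^+ 2.
    by move=> a0 ?; rewrite ltr_pXn2r ?nnegrE //; lra.
  have := sq _ (nm_ge0 _) dm; have := sq _ (nm_ge0 _) dn.
  have : s ^+ 2 <= s by nra.
  have : 0 <= s * d by nra.
  have -> : (d + s) ^+ 2 = d ^+ 2 + 2 * (s * d) + s ^+ 2 by ring.
  move=> *; apply: lt_le_trans s2; lra.
have [l hl] := cauchy_nm cau.
have Sl : S l by apply: cS => e /hl [N hN]; exists (u N) => //; exact: hN.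
have dl : nm (x - l) <= d.
  apply/ler_addgt0Pr; change (forall e : R, 0 < e -> nm (x - l) <= d + e) => e e0.
  have e2 : 0 < e / 2 by lra.
  have [N hN] := hl _ e2.
  have [M _ hM] := near_infty_natSinv_lt (PosNum e2).
  have h1 : (N + M)%N.+1%:R^-1 < e / 2 := hM (N + M)%N (leq_addl _ _).
  have := hN (N + M)%N (leq_addr _ _); rewrite (nmBC l) => h2.
  have := nm_tri (u (N + M)%N) x l; have := du (N + M)%N.
  move: h1 h2; set t := _^-1; move: t (nm _) (nm _) (nm _) => t a b c.
  lra.
exists l => // z Sz.
have key (t : R) : 0 <= - 2 * t * rd (x - l) z + t ^+ 2 * nm z ^+ 2.
  have := dle (l + t%:C%C *: z) (linsubD hS Sl (linsubZ hS _ Sz)).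
  rewrite opprD addrA => h.
  have := @ler_pXn2r _ 2 isT d (nm (x - l - t%:C%C *: z)).
  rewrite !nnegrE d0 nm_ge0 h => /(_ isT isT).
  have := @ler_pXn2r _ 2 isT (nm (x - l)) d.
  rewrite !nnegrE d0 nm_ge0 dl => /(_ isT isT).
  rewrite (nm2B (x - l)) rdZr nmZ exprMn real_normK ?num_real //; lra.
set r := rd (x - l) z in key *; set q := nm z ^+ 2 in key.
have q0 : 0 <= q by rewrite sqr_ge0.
(* The minimum of the quadratic is at [r / q]; adding 1 avoids the case [z = 0] and still leaves a
   negative multiple of [r ^+ 2]. *)
have := key (r / (q + 1)).
have qp : 0 < q + 1 by lra.
have -> : -2 * (r / (q + 1)) * r + (r / (q + 1)) ^+ 2 * q
   = - (r ^+ 2) * ((q + 2) / (q + 1) ^+ 2) by field; lra.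
have : 0 < (q + 2) / (q + 1) ^+ 2 by rewrite divr_gt0 ?exprn_gt0 //; lra.
move=> h1 h2; have : r ^+ 2 <= 0 by nra.
by move=> h3; apply/eqP; rewrite -sqrf_eq0 eq_le h3 sqr_ge0.
Qed.

End inner_product.

(** * Selfadjoint operators *)

Section selfadjoint_operators.
Variables (R : realType) (X : completeNormedModType R[i]).
Variable dot : {dot X for Num.conj}.
Hypothesis hdot : dot_induces_norm dot.
Implicit Types (x y z : X).
Local Notation rd := (rd dot).
Local Notation perp := (perp dot).

Lemma oproj_eq (S : set X) x y :
  linsub S -> S y -> perp S (x - y) -> oproj dot S x = y.
Proof.
move=> hS Sy pxy; apply: xget_subset1.
  by split=> //; exact: dot_eq0 hS pxy.
move=> u v [Su hu] [Sv hv]; apply/eqP; rewrite -subr_eq0; apply/eqP.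
apply: (perp_cap hdot (S := S)); first exact: linsubB.
move=> z Sz; have -> : u - v = (x - v) - (x - u).
  by rewrite opprB [RHS]addrC addrA subrK.
by rewrite rdBl /rd hu // hv // subrr.
Qed.

Variable T : operator X.
Hypothesis T_sa : selfadjoint dot T.

Lemma sa_dom : linsub (dom T).
Proof. by case: T_sa => -[T0 h] _ _; split=> // a x y Tx Ty; case: (h a x y Tx Ty). Qed.

Lemma sa_lin a x y : dom T x -> dom T y -> T (a *: x + y) = a *: T x + T y.
Proof. by case: T_sa => -[T0 h] _ _ Tx Ty; case: (h a x y Tx Ty). Qed.

Lemma sa0 : T 0 = 0.
Proof.
have := sa_lin 1 sa_dom.1 sa_dom.1; rewrite !scale1r addr0 => /esym/eqP.
by rewrite addrC -subr_eq0 addrK => /eqP.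
Qed.

Lemma saZ a x : dom T x -> T (a *: x) = a *: T x.
Proof. by move=> Tx; have := sa_lin a Tx sa_dom.1; rewrite !addr0 sa0 addr0. Qed.

Lemma saD x y : dom T x -> dom T y -> T (x + y) = T x + T y.
Proof. by move=> Tx Ty; have := sa_lin 1 Tx Ty; rewrite !scale1r. Qed.

Lemma saN x : dom T x -> T (- x) = - T x.
Proof. by move=> Tx; rewrite -scaleN1r saZ // scaleN1r. Qed.

Lemma saB x y : dom T x -> dom T y -> T (x - y) = T x - T y.
Proof. by move=> Tx Ty; rewrite saD ?saN //; exact: (linsubN sa_dom). Qed.

Lemma sa_sym x y : dom T x -> dom T y -> dot (T x) y = dot x (T y).
Proof.
case: T_sa => _ _ [ad Tad] Tx Ty.
have ay : dom (adjoint dot T) y by rewrite ad.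
have [z hz] := ay.
rewrite -(Tad _ ay) /=.
have := xgetPex 0 (ex_intro (fun z => forall x, dom T x -> dot (T x) y = dot x z) z hz).
exact.
Qed.

Lemma sa_rd x y : dom T x -> dom T y -> rd (T x) y = rd x (T y).
Proof. by move=> Tx Ty; rewrite /rd sa_sym. Qed.

Lemma sa_dense x (e : R) : 0 < e -> exists2 y, dom T y & nm (x - y) < e.
Proof. by case: T_sa => _ cl _; exact: closure_nm. Qed.

Lemma perp_dense z : (forall x, dom T x -> rd z x = 0) -> z = 0.
Proof.
move=> h; apply: (perp_cap hdot (S := setT)) => // y _.
have h' : perp (dom T) z by [].
apply/eqP; rewrite -normr_le0; apply/ler_addgt0Pr => e e0; rewrite add0r.
have z0 := nm_ge0 z.
have [|x Tx xy] := @sa_dense y (e / (nm z + 1)); first by rewrite divr_gt0 //; lra.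
rewrite -[y](subrK x) rdDr (h x Tx) addr0.
apply: le_trans (rd_CS hdot _ _) _.
move: xy; rewrite ltr_pdivlMr; last lra.
by have := nm_ge0 (y - x); nra.
Qed.

(** A selfadjoint operator has no proper symmetric extension. Real parts suffice as a test, because
    [x] may be replaced by ['i x]. *)
Lemma sa_max y z : (forall x, dom T x -> rd (T x) y = rd x z) ->
  dom T y /\ T y = z.
Proof.
move=> h; have h' x : dom T x -> dot (T x) y = dot x z.
  move=> Tx; apply/eqP; rewrite eq_complex; apply/andP; split; apply/eqP.
    exact: h.
  have := h _ (linsubZ sa_dom 'i%C Tx).
  rewrite saZ // /rd !dotZl; case: (dot _ y) (dot _ z) => a b [c d] /=.
  by rewrite !mul0r !mul1r !sub0r => /oppr_inj.
have Ty : dom T y.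
  by case: T_sa => _ _ [<- _]; exists z.
split=> //; apply/eqP; rewrite -subr_eq0; apply/eqP; apply: perp_dense => x Tx.
by rewrite rdC rdBr -sa_rd // h // subrr.
Qed.

(** The identity tested in [sa_max] is continuous in [y] and [z], so it passes to limits in the
    graph. *)
Lemma sa_closed y z :
  (forall e : R, 0 < e -> exists u, [/\ dom T u, nm (y - u) < e & nm (z - T u) < e]) ->
  dom T y /\ T y = z.
Proof.
move=> h; apply: sa_max => x Tx; apply/eqP; rewrite -subr_eq0 -normr_le0.
apply/ler_addgt0Pr; change (forall e : R, 0 < e -> `|rd (T x) y - rd x z| <= 0 + e) => e e0.
have x0 := nm_ge0 x; have Tx0 := nm_ge0 (T x).
have [|u [Tu yu zu]] := h (e / (nm x + nm (T x) + 1)).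
  by rewrite divr_gt0 //; lra.
have -> : rd (T x) y - rd x z = rd (T x) (y - u) - rd x (z - T u).
  by rewrite !rdBr (sa_rd Tx Tu); ring.
rewrite add0r (le_trans (ler_normB _ _)) //.
have := rd_CS hdot (T x) (y - u); have := rd_CS hdot x (z - T u).
move: yu zu; rewrite !ltr_pdivlMr; try lra.
move: (nm (T x)) (nm x) (nm (y - u)) (nm (z - T u)) (nm_ge0 (y - u)) (nm_ge0 (z - T u)) x0 Tx0.
move=> a b c d c0 d0 b0 a0 h1 h2 h3 h4.
have : a * c + b * d <= e by nra.
lra.
Qed.

Lemma ker_linsub : linsub (op_ker T).
Proof.
split; first by split; [exact: sa_dom.1|exact: sa0].
move=> a x y [Tx x0] [Ty y0]; split; first exact: sa_dom.2.
by rewrite sa_lin // x0 y0 scaler0 addr0.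
Qed.

Lemma ker_closed : nmclosed (op_ker T).
Proof.
move=> x h; apply: sa_closed => e /h [u [Tu u0] xu]; exists u; split=> //.
by rewrite u0 subr0 nm0; apply: le_lt_trans xu; exact: nm_ge0.
Qed.

Lemma range_perp_ker x : dom T x -> perp (op_ker T) (T x).
Proof. by move=> Tx k [Tk k0]; rewrite sa_rd // k0 rd0r. Qed.

Lemma perp_range_ker z : perp (op_range T) z -> op_ker T z.
Proof.
move=> h; apply: sa_max => x Tx; rewrite rd0r rdC; apply: h.
by exists x.
Qed.

Lemma sa_decomp x : exists k, [/\ op_ker T k, perp (op_ker T) (x - k),
  dom T x -> dom T (x - k) & dom T x -> T (x - k) = T x].
Proof.
have [k kk pk] := projection_theorem hdot ker_linsub ker_closed x.
exists k; case: (kk) => Tk k0; split=> // Tx; first exact: (linsubB sa_dom).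
by rewrite saB // k0 subr0.
Qed.

(** The lower bound turns Cauchy sequences of images into Cauchy sequences of preimages, so the
    range is closed; its orthogonal complement is the kernel. Applied to [L] and to [H]. *)
Lemma closed_range (c : R) : 0 < c ->
  (forall g, dom T g -> perp (op_ker T) g -> c * nm g <= nm (T g)) ->
  op_range T = perp (op_ker T).
Proof.
move=> c0 hc; apply/seteqP; split=> [_ [x Tx <-]|w pw]; first exact: range_perp_ker.
have sR : linsub (op_range T).
  split=> [|a _ _ [x Tx <-] [y Ty <-]]; first by exists 0; [exact: sa_dom.1|exact: sa0].
  by exists (a *: x + y); [exact: sa_dom.2|rewrite sa_lin].
have pS := perp_linsub dot ker_linsub.
have cR : nmclosed (op_range T).
  move=> y hy.
  have ex (n : nat) : exists g, [/\ dom T g, perp (op_ker T) g & nm (y - T g) < n.+1%:R^-1].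
    have [|_ [x Tx <-] xy] := hy n.+1%:R^-1; first by rewrite invr_gt0 ltr0n.
    (* Preimages are taken orthogonal to the kernel so that [hc] applies to their differences. *)
    have [k [kk pk Tk TE]] := sa_decomp x.
    by exists (x - k); split=> //; [exact: Tk|rewrite TE].
  have [u hu] := choice ex.
  have small (e : R) : 0 < e -> exists N, forall n, (N <= n)%N -> nm (y - T (u n)) < e.
    move=> e0; have [N _ hN] := near_infty_natSinv_lt (PosNum e0).
    exists N => n Nn; case: (hu n) => _ _ h; apply: lt_trans h _; exact: (hN n).
  have [g hg] : exists g, forall e : R, 0 < e ->
      exists N, forall n, (N <= n)%N -> nm (g - u n) < e.
    apply: cauchy_nm => e e0; have e2 : 0 < c * e / 2 by rewrite divr_gt0 ?mulr_gt0.
    have [N hN] := small _ e2; exists N => m n Nm Nn.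
    have [Tm pm _] := hu m; have [Tn pn _] := hu n.
    have := hc _ (linsubB sa_dom Tm Tn) (linsubB pS pm pn).
    rewrite saB //; have := nm_tri y (T (u m)) (T (u n)).
    have := hN _ Nm; have := hN _ Nn; rewrite (nmBC (T (u m)) y).
    move: (nm _) (nm _) (nm _) (nm _) => p q r s h1 h2 h3 h4.
    have : c * p < c * e by lra.
    by rewrite ltr_pM2l.
  have [] : dom T g /\ T g = y.
    apply: sa_closed => e e0; have [N hN] := hg _ e0; have [M hM] := small _ e0.
    exists (u (N + M)%N); have [Tu _ _] := hu (N + M)%N; split=> //.
      by apply: hN; rewrite leq_addr.
    by apply: hM; rewrite leq_addl.
  by exists g.
have [p [x Tx xp] pp] := projection_theorem hdot sR cR w.
have z0 : w - p = 0.
  apply: (perp_cap hdot (S := op_ker T)); first exact: perp_range_ker.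
  by apply: (linsubB pS) => //; rewrite -xp; exact: range_perp_ker.
by exists x => //; rewrite xp; apply/esym/eqP; rewrite -subr_eq0 z0.
Qed.

End selfadjoint_operators.

(** * Norm closures of subspaces *)

Section closure.
Variables (R : realType) (X : completeNormedModType R[i]).
Implicit Types S : set X.

Definition nmcl S : set X :=
  [set x | forall e : R, 0 < e -> exists2 y, S y & nm (x - y) < e].

Lemma nmcl_incl S : S `<=` nmcl S.
Proof. by move=> x Sx e e0; exists x => //; rewrite subrr nm0. Qed.

Lemma nmcl_closed S : nmclosed (nmcl S).
Proof.
move=> x h e e0; have e2 : 0 < e / 2 by lra.
have [y hy xy] := h _ e2; have [z Sz yz] := hy _ e2.
by exists z => //; have := nm_tri y x z; lra.
Qed.

Lemma nmcl_linsub S : linsub S -> linsub (nmcl S).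
Proof.
move=> hS; split; first by apply: nmcl_incl; exact: hS.1.
move=> a x y hx hy e e0.
have a0 : 0 <= complex.Re `|a| by rewrite -ler0c RRe_real ?normr_real.
have [|u Su xu] := hx (e / (2 * (complex.Re `|a| + 1))); first by rewrite divr_gt0 //; lra.
have [|v Sv yv] := hy (e / 2); first by lra.
exists (a *: u + v); first exact: hS.2.
have -> : a *: x + y - (a *: u + v) = a *: (x - u) + (y - v).
  by rewrite opprD addrACA scalerBr.
apply: le_lt_trans (nmD _ _) _.
rewrite nmZc.
move: xu; rewrite ltr_pdivlMr; last lra.
have := nm_ge0 (x - u); nra.
Qed.

Lemma nmcl_sub S S' : S `<=` S' -> nmclosed S' -> nmcl S `<=` S'.
Proof. by move=> SS' cS' x h; apply: cS' => e /h [y Sy xy]; exists y => //; exact: SS'. Qed.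

End closure.

(** * Nonnegative operators with a spectral gap *)

Section spectral_gap.
Variables (R : realType) (X : completeNormedModType R[i]).
Variable dot : {dot X for Num.conj}.
Hypothesis hdot : dot_induces_norm dot.
Implicit Types (x y z : X).
Local Notation rd := (rd dot).
Local Notation perp := (perp dot).

Lemma resolvent_bound (T : operator X) (z : R[i]) : resolvent_set T z ->
  exists2 M : R, 0 < M & forall x, dom T x -> nm x <= M * nm (T x - z *: x).
Proof.
move=> [S [cS _ ST]]; have [M M0 hM] := continuous_nm cS.
by exists M => // x Tx; rewrite -{1}(ST x Tx); exact: hM.
Qed.

(* With [m] the norm of S, the vectors [S (S x) - m ^+ 2 x] become arbitrarily
   small on unit vectors x almost attaining the norm, so S - m and S + m cannot
   both be bounded below. *)
Lemma symmetric_norm_bound (S : {linear X -> X}) (M a : R) :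
  (forall x, nm (S x) <= M * nm x) -> 0 <= a ->
  (forall x y, rd (S x) y = rd x (S y)) ->
  (forall m, a < m -> exists2 C, 0 < C & forall x,
    nm x <= C * nm (S x - m%:C%C *: x) /\ nm x <= C * nm (S x + m%:C%C *: x)) ->
  forall x, nm (S x) <= a * nm x.
Proof.
move=> hM a0 sym hC.
pose Q := [set t : R | 0 <= t /\ forall x, nm (S x) <= t * nm x].
have Q0 : Q !=set0.
  exists `|M|; split=> // x; apply: le_trans (hM x) _.
  by rewrite ler_wpM2r ?nm_ge0 // ler_norm.
have hQ : has_inf Q by split=> //; exists 0 => t [].
pose m := inf Q.
have m0 : 0 <= m by apply: lb_le_inf => // t [].
have mb x : nm (S x) <= m * nm x.
  apply/ler_addgt0Pr; change (forall e : R, 0 < e -> nm (S x) <= m * nm x + e) => e e0.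
  have x0 := nm_ge0 x.
  have e1 : 0 < e / (nm x + 1) by rewrite divr_gt0 //; lra.
  have [t [t0 ht] tm] := inf_adherent e1 hQ.
  apply: le_trans (ht x) _.
  have : t * nm x <= (m + e / (nm x + 1)) * nm x by rewrite ler_wpM2r // ltW.
  have : e / (nm x + 1) * nm x <= e.
    by rewrite mulrAC ler_pdivrMr; [nra|lra].
  lra.
suff ma : m <= a by move=> x; apply: le_trans (mb x) _; rewrite ler_wpM2r ?nm_ge0.
rewrite leNgt; apply/negP => am.
have [C C0 hCm] := hC _ am.
have m1 : 0 < m by lra.
(* Composing the two lower bounds uses [(S + m) (S - m) = S ^ 2 - m ^ 2]. *)
have key x : nm x <= C ^+ 2 * nm (S (S x) - (m ^+ 2)%:C%C *: x).
  have [h1 _] := hCm x.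
  have [_ h2] := hCm (S x - m%:C%C *: x).
  have E : S (S x - m%:C%C *: x) + m%:C%C *: (S x - m%:C%C *: x)
     = S (S x) - (m ^+ 2)%:C%C *: x.
    by rewrite linearB linearZ /= scalerBr scalerA -rmorphM -expr2 addrA subrK.
  rewrite E in h2.
  have := nm_ge0 (S x - m%:C%C *: x); nra.
pose K : R := (C ^+ 4)^-1.
have K0 : 0 < K by rewrite invr_gt0 exprn_gt0.
(* Expanding the squared norm of [S (S x) - m ^+ 2 x] and using [|S (S x)| <= m |S x|] turns the
   lower bound [key] into an upper bound for [S] strictly better than [m]. *)
have key2 x : m ^+ 2 * nm (S x) ^+ 2 <= (m ^+ 4 - K) * nm x ^+ 2.
  have h := key x; have h1 := mb (S x).
  have E : nm (S (S x) - (m ^+ 2)%:C%C *: x) ^+ 2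
     = nm (S (S x)) ^+ 2 - 2 * m ^+ 2 * nm (S x) ^+ 2 + m ^+ 4 * nm x ^+ 2.
    rewrite (nm2B hdot) rdZr sym (rdxx hdot) nmZ exprMn real_normK ?num_real //; ring.
  have {}h : nm x ^+ 2 <= C ^+ 4 * nm (S (S x) - (m ^+ 2)%:C%C *: x) ^+ 2.
    have -> : C ^+ 4 * nm (S (S x) - (m ^+ 2)%:C%C *: x) ^+ 2
      = (C ^+ 2 * nm (S (S x) - (m ^+ 2)%:C%C *: x)) ^+ 2 by ring.
    by rewrite ler_pXn2r ?nnegrE ?mulr_ge0 ?exprn_ge0 ?nm_ge0 //; lra.
  have {}h : K * nm x ^+ 2 <= nm (S (S x) - (m ^+ 2)%:C%C *: x) ^+ 2.
    by rewrite mulrC ler_pdivrMr ?exprn_gt0 // mulrC.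
  have h2 : nm (S (S x)) ^+ 2 <= m ^+ 2 * nm (S x) ^+ 2.
    by rewrite -exprMn ler_pXn2r ?nnegrE ?mulr_ge0 ?nm_ge0.
  rewrite E in h; lra.
(* [Num.sqrt q] is a bound for [S] below the infimum [m]; the maximum with 0 makes [q] the square of
   its root. *)
pose q := Num.max 0 (m ^+ 2 - K / m ^+ 2).
have q0 : 0 <= q by rewrite le_max lexx.
have m2 : 0 < m ^+ 2 by rewrite exprn_gt0.
have qm : q < m ^+ 2.
  by rewrite gt_max m2 /= ltrBlDr ltrDl divr_gt0.
have Qq : Q (Num.sqrt q).
  split; first exact: sqrtr_ge0.
  move=> x; rewrite -(ler_pXn2r (n := 2)) ?nnegrE ?mulr_ge0 ?sqrtr_ge0 ?nm_ge0 //.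
  rewrite exprMn sqr_sqrtr //.
  have : nm (S x) ^+ 2 <= (m ^+ 2 - K / m ^+ 2) * nm x ^+ 2.
    rewrite -(ler_pM2l m2); apply: le_trans (key2 x) _.
    by rewrite le_eqVlt; apply/orP; left; apply/eqP; field; lra.
  move/le_trans; apply; rewrite ler_wpM2r ?sqr_ge0 //.
  by rewrite le_max lexx orbT.
have : m <= Num.sqrt q by exact: (inf_lbound hQ.2).
rewrite -(ler_pXn2r (n := 2)) ?nnegrE ?sqrtr_ge0 // sqr_sqrtr //; lra.
Qed.

Variables B L : operator X.
Hypotheses (B_sa : selfadjoint dot B) (B_ge0 : nonneg_op dot B).
Hypothesis L_sqrt : is_sqrt_op dot B L.
Variable l : R.
Hypotheses (l0 : 0 < l) (hI :
  spectrum B `<=` [set t%:C%C | t in [set t : R | t = 0 \/ 2 * l <= t]]).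

Lemma gap_resolvent t : 0 < t -> t < 2 * l -> resolvent_set B t%:C%C.
Proof.
move=> t0 td; apply: contrapT => /hI [s hs] /complexI st; subst s.
case: hs => ?; lra.
Qed.

Lemma sqrt_sa : selfadjoint dot L. Proof. by case: L_sqrt. Qed.

Lemma sqrtE x : dom B x <-> dom L x /\ dom L (L x).
Proof. by case: L_sqrt => _ _ [<- _]. Qed.

Lemma sqrtB x : dom B x -> L (L x) = B x.
Proof. by case: L_sqrt => _ _ [e h]; rewrite -e => /h. Qed.

Lemma ker_sqrt : op_ker B = op_ker L.
Proof.
apply/seteqP; split=> [x [Bx x0]|x [Lx x0]].
  have [Lx LLx] := (sqrtE x).1 Bx; split=> //.
  apply/nm_eq0/eqP; rewrite -sqrf_eq0 -(rdxx hdot) (sa_rd sqrt_sa) //.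
  by rewrite sqrtB // x0 rd0r.
have Bx : dom B x by apply/sqrtE; rewrite x0; split=> //; exact: (sa_dom sqrt_sa).1.
by split=> //; rewrite -sqrtB // x0 (sa0 sqrt_sa).
Qed.

(** For [m > 1 / l] both points [l + 1 / m] and [l - 1 / m] lie in the gap, and a lower bound for
    [B] minus such a point becomes one for [S - m] or [S + m]. This feeds [symmetric_norm_bound]
    with [a = 1 / l]. *)
Lemma gap_inverse : exists S : {linear X -> X},
  [/\ forall y, dom B (S y) /\ B (S y) - l%:C%C *: S y = y,
      forall x, dom B x -> S (B x - l%:C%C *: x) = x,
      forall x y, rd (S x) y = rd x (S y) &
      forall x, l * nm (S x) <= nm x].
Proof.
have ld : l < 2 * l by rewrite mulr_natl mulr2n ltrDl.
have [S [cS BS SB]] := gap_resolvent l0 ld.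
have [M M0 hM] := continuous_nm cS.
have sym x y : rd (S x) y = rd x (S y).
  have [Bx Ex] := BS x; have [By Ey] := BS y.
  rewrite -{1}Ey -{2}Ex rdBr rdBl rdZl rdZr (sa_rd B_sa) //.
exists S; split=> // x.
suff h : forall x, nm (S x) <= l^-1 * nm x.
  by rewrite mulrC -ler_pdivlMr // mulrC.
have il : 0 < l^-1 by rewrite invr_gt0.
apply: symmetric_norm_bound hM _ sym _; first exact: ltW.
move=> m lm; have m0 : 0 < m by lra.
have im : 0 < m^-1 by rewrite invr_gt0.
have iml : m^-1 < l by rewrite -[l]invrK ltf_pV2 ?posrE.
(* The sign [s] treats [S - m] and [S + m] together. *)
have low (s : R) : s ^+ 2 = 1 -> exists2 C, 0 < C & forall x,
    nm x <= C * nm (S x - (s * m)%:C%C *: x).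
  move=> s2; have s1 : s = 1 \/ s = -1.
    by move/eqP: s2; rewrite sqrf_eq1 => /orP[] /eqP ->; [left|right].
  have [N N0 hN] : exists2 N : R, 0 < N &
      forall x, dom B x -> nm x <= N * nm (B x - (l + s / m)%:C%C *: x).
    apply: resolvent_bound; apply: gap_resolvent; move: iml l0; by case: s1 => -> *; lra.
  (* With [r] the norm of [S y - s m y], one has [|y| <= (|S y| + r) / m] and [|S y| <= N r / m]. *)
  exists ((1 + N / m) / m).
    by rewrite divr_gt0 // addr_gt0 // divr_gt0.
  move=> y; have [By Ey] := BS y.
  have := hN _ By.
  have -> : B (S y) - (l + s / m)%:C%C *: S y = y - (s / m)%:C%C *: S y.
    by rewrite rmorphD scalerDl opprD addrA Ey.
  have E : nm (y - (s / m)%:C%C *: S y) = m^-1 * nm (S y - (s * m)%:C%C *: y).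
    have -> : y - (s / m)%:C%C *: S y = (- (s / m))%:C%C *: (S y - (s * m)%:C%C *: y).
      rewrite scalerBr scalerA -rmorphM /= !rmorphN !scaleNr addrC.
      have -> : - (s / m) * (s * m) = - (s ^+ 2) by field; lra.
      by rewrite s2 rmorphN rmorph1 scaleN1r opprK addrC.
    rewrite nmZ normrN normrM (ger0_norm (ltW im)).
    have -> : `|s| = 1 by case: s1 => ->; rewrite ?normrN normr1.
    by rewrite mul1r.
  have := nm_tri ((s / m)%:C%C *: S y) y 0.
  rewrite !subr0 E nmZ.
  have -> : `|s / m| = m^-1.
    rewrite normrM (ger0_norm (ltW im)).
    have -> : `|s| = 1 by case: s1 => ->; rewrite ?normrN normr1.
    by rewrite mul1r.
  move: (nm y) (nm (S y)) (nm (S y - _)) => p q r h1 h2.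
  have h3 : m^-1 * q <= m^-1 * (N * (m^-1 * r)) by rewrite ler_pM2l.
  have -> : (1 + N / m) / m * r = m^-1 * r + m^-1 * (N * (m^-1 * r)) by ring.
  lra.
have [C1 C10 h1] := low 1 (expr1n _ _).
have [C2 C20 h2] := low (-1) (etrans (sqrrN 1) (expr1n _ _)).
exists (C1 + C2); first by lra.
move=> y; split.
  apply: le_trans (h1 y) _; rewrite mul1r ler_wpM2r ?nm_ge0 //; lra.
apply: le_trans (h2 y) _; rewrite mulN1r rmorphN scaleNr opprK ler_wpM2r ?nm_ge0 //; lra.
Qed.

(* The operator [C := B (B - l)^-1] is bounded with [<C x, x> <= |C x|^2]; the
   Cauchy-Schwarz inequality for the form [<C x, y>] then bounds it below on its
   range, hence on the closure of its range, which is the complement of the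
   kernel. *)
Lemma sqrt_lower_bound : exists2 c : R, 0 < c &
  forall x, dom L x -> perp (op_ker L) x -> c * nm x <= nm (L x).
Proof.
have [S [BS SB sym Sb]] := gap_inverse.
pose C x := B (S x).
have CE x : C x = x + l%:C%C *: S x.
  by have [_ {2}<-] := BS x; rewrite subrK.
have Csym x y : rd (C x) y = rd x (C y).
  by rewrite !CE rdDl rdDr rdZl rdZr sym.
have Clin a x y : C (a *: x + y) = a *: C x + C y.
  by rewrite !CE linearP !scalerDr addrACA !scalerA (mulrC a).
have C00 : C 0 = 0 by rewrite CE linear0 scaler0 addr0.
have Cb x : nm (C x) <= 2 * nm x.
  rewrite CE; have := nmD x (l%:C%C *: S x); rewrite nmZ ger0_norm; last exact: ltW.
  have := Sb x; lra.
(* This is [l |u| <= |(B - l) u|] squared: the terms [l ^ 2 |u| ^ 2] cancel. *)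
have Bl u : dom B u -> 2 * l * rd (B u) u <= nm (B u) ^+ 2.
  move=> Bu; have := Sb (B u - l%:C%C *: u); rewrite (SB _ Bu) => h.
  have : (l * nm u) ^+ 2 <= nm (B u - l%:C%C *: u) ^+ 2.
    have ll := ltW l0.
    by rewrite ler_pXn2r ?nnegrE ?mulr_ge0 ?nm_ge0.
  rewrite (nm2B hdot) rdZr nmZ !exprMn real_normK ?num_real //; lra.
have CxxE x : rd (C x) x = nm (C x) ^+ 2 - l * rd (B (S x)) (S x).
  have [_ Ex] := BS x; rewrite -{2}Ex rdBr rdZr -/(C x) (rdxx hdot) //.
have Cge x : nm (C x) ^+ 2 <= 2 * rd (C x) x.
  have := Bl _ (BS x).1; rewrite CxxE -/(C x); lra.
have Cle x : rd (C x) x <= nm (C x) ^+ 2.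
  rewrite CxxE; have : 0 <= rd (B (S x)) (S x).
    by have := B_ge0 (BS x).1; rewrite lecE => /andP[].
  by move: l0; nra.
have C0 x : 0 <= rd (C x) x by have := Cge x; have := sqr_ge0 (nm (C x)); lra.
have CS x y : rd (C x) y ^+ 2 <= rd (C x) x * rd (C y) y.
  apply: (nonneg_form_CS (q := fun x y => rd (C x) y)) => //.
  - move=> u v w; have := Clin 1 u v; rewrite !scale1r => ->; exact: rdDl.
  - by move=> u v; rewrite Csym rdC.
  - by move=> t u v; have := Clin t%:C%C u 0; rewrite C00 !addr0 => ->; rewrite rdZl.
(* Cauchy-Schwarz for the form at [y] and [C y] gives [|C y| ^ 4 <= <C y, y> <C (C y), C y>], where
   the first factor is at most [|C y| ^ 2]. *)
have Crange y : nm (C y) <= nm (C (C y)).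
  have h1 := CS y (C y); rewrite (rdxx hdot) in h1.
  have h2 : rd (C (C y)) (C y) <= nm (C (C y)) * nm (C y) by exact: rd_le.
  have := Cle y; have := C0 y; have := C0 (C y).
  have := nm_ge0 (C y); have := nm_ge0 (C (C y)).
  set a := nm (C y) in h1 h2 *; set b := nm (C (C y)) in h2 *.
  set p := rd (C y) y in h1 *; set q := rd (C (C y)) (C y) in h1 h2 *.
  move=> b0 a0 q0 p0 pa.
  have : (a ^+ 2) ^+ 2 <= a ^+ 2 * (b * a).
    by apply: le_trans h1 _; apply: ler_pM.
  have [a1|a1] := eqVneq a 0; first by rewrite a1.
  have ap : 0 < a by rewrite lt_neqAle eq_sym a1.
  have -> : (a ^+ 2) ^+ 2 = a ^+ 3 * a by ring.
  have -> : a ^+ 2 * (b * a) = a ^+ 3 * b by ring.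
  by rewrite ler_pM2l // exprn_gt0.
have Csub x y : C (x - y) = C x - C y.
  by rewrite !CE linearB scalerBr opprD addrACA.
have kB := ker_sqrt.
have Crange_perp : range C `<=` perp (op_ker L).
  by move=> _ [x _ <-]; rewrite -kB; apply: range_perp_ker => //; exact: (BS x).1.
have Cperp w : perp (op_ker L) w -> nm w <= nm (C w).
  move=> pw.
  have lin : linsub (range C).
    split; first by exists 0 => //; rewrite CE linear0 scaler0 addr0.
    by move=> a _ _ [x _ <-] [y _ <-]; exists (a *: x + y).
  have [p clp pp] := projection_theorem hdot (nmcl_linsub lin) (@nmcl_closed _ _ _) w.
  (* The difference is killed by [C = 1 + l S], so it is a multiple of [S (w - p)], which [B]
     annihilates. It thus lies in the kernel and in its complement. *)
  have wp : w = p.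
    apply/eqP; rewrite -subr_eq0; apply/eqP; apply: (perp_cap hdot (S := op_ker L)).
      have Cz : C (w - p) = 0.
        apply: (perp_cap hdot (S := setT)) => // y _.
        by rewrite Csym; apply: pp; apply: nmcl_incl; exists y.
      have [Bz _] := BS (w - p).
      rewrite -kB; have zE : w - p = (- l)%:C%C *: S (w - p).
        by rewrite rmorphN scaleNr; apply/eqP; rewrite -subr_eq0 opprK -CE Cz.
      rewrite zE; apply: (linsubZ (ker_linsub B_sa)); split=> //.
    apply: (linsubB (perp_linsub dot (ker_linsub sqrt_sa))) => //.
    exact: nmcl_sub Crange_perp (@perp_closed _ _ _ hdot _) _ clp.
  apply/ler_addgt0Pr; change (forall e : R, 0 < e -> nm w <= nm (C w) + e) => e e0.
  (* Replacing [w] by [C y] costs one unit of error, and replacing [C (C y)] by [C w] two more since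
     [|C| <= 2]. *)
  have e4 : 0 < e / 4 by lra.
  have := clp _ e4; rewrite -wp => -[_ [y _ <-] wy].
  have := nm_tri (C y) w 0; have := Crange y; have := nm_tri (C w) (C (C y)) 0.
  have := Cb (w - C y); rewrite Csub (nmBC (C (C y)) (C w)) !subr0.
  lra.
(* The estimates below give [l |x| ^ 2 <= 8 |L x| ^ 2]; the square of [l / (8 + l)] is at most
   [l / 8], which avoids a square root in the constant. *)
exists (l / (8 + l)); first by rewrite divr_gt0 // addr_gt0.
move=> x Lx px.
have [BSx _] := BS x; have [LSx LLSx] := (sqrtE _).1 BSx.
(* The chain is [|x| ^ 2 <= 2 <C x, x> = 2 <L (S x), L x>], combined with
   [|L (S x)| ^ 2 = <C x, S x>] and [l |S x| <= |x|]. *)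
have h1 : nm x ^+ 2 <= 2 * rd (C x) x.
  apply: le_trans (Cge x); rewrite ler_pXn2r ?nnegrE ?nm_ge0 //; exact: Cperp.
have h2 : rd (C x) x <= nm (L (S x)) * nm (L x).
  by rewrite /C -sqrtB // (sa_rd sqrt_sa) //; exact: rd_le.
have h3 : nm (L (S x)) ^+ 2 <= 2 * nm x * nm (S x).
  rewrite -(rdxx hdot) -(sa_rd sqrt_sa) // sqrtB //.
  apply: le_trans (rd_le hdot _ _) _; rewrite ler_wpM2r ?nm_ge0 //; exact: Cb.
have h4 := Sb x.
have := nm_ge0 x; have := nm_ge0 (L x); have := nm_ge0 (L (S x)); have := nm_ge0 (S x).
move: h1 h2 h3 h4 l0; move: (nm x) (nm (L x)) (nm (L (S x))) (nm (S x)) (rd _ _) l.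
move=> a b p q r t h1 h2 h3 h4 t0 q0 p0 b0 a0.
have h5 : t * p ^+ 2 <= 2 * a ^+ 2 by nra.
have [->|a1] := eqVneq a 0; first by rewrite mulr0.
have ap : 0 < a by rewrite lt_neqAle eq_sym a1.
have h6 : (a ^+ 2) ^+ 2 <= (2 * (p * b)) ^+ 2.
  by rewrite ler_pXn2r ?nnegrE ?sqr_ge0 ?mulr_ge0 //; lra.
have h7 : t * a ^+ 2 <= 8 * b ^+ 2.
  rewrite -(ler_pM2l (x := a ^+ 2)) ?exprn_gt0 //.
  have := sqr_ge0 b; nra.
have tp : 0 < 8 + t by lra.
have t1 : 0 <= t / (8 + t) * a by rewrite mulr_ge0 // divr_ge0 //; lra.
rewrite -(ler_pXn2r (n := 2)) ?nnegrE // exprMn expr_div_n mulrAC ler_pdivrMr ?exprn_gt0 //.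
have := sqr_ge0 a; have := sqr_ge0 b; nra.
Qed.

Lemma sqrt_range : op_range L = perp (op_ker L).
Proof. by have [c c0 hc] := sqrt_lower_bound; exact: (closed_range hdot sqrt_sa c0 hc). Qed.
End spectral_gap.

(** * Orthogonal projections and finite-dimensional expansions *)

Section projections.
Variables (R : realType) (X : completeNormedModType R[i]).
Variable dot : {dot X for Num.conj}.
Hypothesis hdot : dot_induces_norm dot.
Implicit Types (x y z : X).
Local Notation rd := (rd dot).
Local Notation perp := (perp dot).

(** Real and imaginary parts are bounded separately. The factor 2 is crude but enough for the
    boundedness of [P]. *)
Lemma dot_bound x y : complex.Re `|dot x y| <= 2 * (nm x * nm y).
Proof.
have h1 := rd_CS hdot x y; have h2 := rd_CS hdot x ('i%C *: y).
rewrite nmZi rdi in h2; move: h1 h2; rewrite /rd.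
set c := nm x * nm y; case: (dot x y) => a b /= ha hb.
rewrite -(ler_pXn2r (n := 2)) ?nnegrE ?sqrtr_ge0 //; last first.
  by rewrite mulr_ge0 // (le_trans _ ha).
rewrite sqr_sqrtr ?addr_ge0 ?sqr_ge0 //.
rewrite -(real_normK (num_real a)) -(real_normK (num_real b)).
have := normr_ge0 a; have := normr_ge0 b; nra.
Qed.

Lemma linear_map0 (f : X -> X) : linear f -> f 0 = 0.
Proof.
by move=> lf; have := lf (-1) 0 0; rewrite !scaleN1r oppr0 addr0 addNr.
Qed.

Section one_projection.
Variable S : set X.
Hypotheses (hS : linsub S) (cS : nmclosed S).

Lemma oproj_in x : S (oproj dot S x).
Proof.
by have [y Sy py] := projection_theorem hdot hS cS x;
  rewrite (oproj_eq hdot hS Sy py).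
Qed.

Lemma oproj_perp x : perp S (x - oproj dot S x).
Proof.
by have [y Sy py] := projection_theorem hdot hS cS x;
  rewrite (oproj_eq hdot hS Sy py).
Qed.

Lemma oproj_linear : linear (oproj dot S).
Proof.
move=> a x y; apply: oproj_eq => //.
  by apply: hS.2; exact: oproj_in.
rewrite opprD addrACA -scalerBr; apply: (perp_linsub dot hS).2; exact: oproj_perp.
Qed.

Lemma oproj_eq0 x : perp S x -> oproj dot S x = 0.
Proof. by move=> px; apply: oproj_eq => //; [exact: hS.1|rewrite subr0]. Qed.

Lemma oproj_nm x : nm (x - oproj dot S x) <= nm x.
Proof.
rewrite -(ler_pXn2r (n := 2)) ?nnegrE ?nm_ge0 //.
have := nm2D hdot (x - oproj dot S x) (oproj dot S x).
rewrite subrK (oproj_perp x (oproj_in x)) => ->.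
by rewrite mulr0 addr0 lerDl sqr_ge0.
Qed.

End one_projection.

(* Possibly zero vectors are harmless since [dot 0 0 = 0] and [0^-1 = 0]. *)
Definition fourier (s : seq X) x : X := \sum_(f <- s) (dot x f / dot f f) *: f.

Lemma fourier_linear s : linear (fourier s).
Proof.
move=> a x y; rewrite /fourier scaler_sumr -big_split /=; apply: eq_bigr => f _.
by rewrite dotDl dotZl mulrDl scalerDl scalerA mulrA.
Qed.

Lemma dot_suml (I : Type) (s : seq I) (F : I -> X) y :
  dot (\sum_(i <- s) F i) y = \sum_(i <- s) dot (F i) y.
Proof. exact: linear_sumlz. Qed.

Lemma dot_sumr (I : Type) (s : seq I) (F : I -> X) y :
  dot y (\sum_(i <- s) F i) = \sum_(i <- s) dot y (F i).
Proof. exact: linear_sumr. Qed.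

Lemma fourier_sym s x y : dot (fourier s x) y = dot x (fourier s y).
Proof.
rewrite /fourier dot_suml dot_sumr; apply: eq_bigr => f _.
rewrite dotZl dotZr rmorphM fmorphV /= -(dotC dot f y) -(dotC dot f f).
by rewrite mulrAC [RHS]mulrAC (mulrC (dot x f)).
Qed.

(** Gram-Schmidt by induction on the number of spanning vectors. The invariant is that [fourier s]
    fixes the span; orthogonality of the new vector [r] to it then follows from [fourier_sym]. *)
Lemma fourier_basis S : finite_dimensional S ->
  exists2 s, {in s, forall f, S f} & forall x, S x -> fourier s x = x.
Proof.
move=> [n [e ->]]; elim: n e => [|n IH] e.
  by exists [::] => // x [c _ <-]; rewrite /fourier big_nil big_ord0.
pose e' (i : 'I_n) := e (widen_ord (leqnSn n) i).
have [s sS hs] := IH e'; pose e1 := e ord_max; pose r := e1 - fourier s e1.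
pose S' := range (fun c : 'I_n -> R[i] => \sum_(i < n) c i *: e' i).
pose T' := range (fun c : 'I_n.+1 -> R[i] => \sum_(i < n.+1) c i *: e i).
have T'E x : T' x <-> exists2 y, S' y & exists a, x = y + a *: e1.
  split=> [[c _ <-]|[_ [c _ <-] [a ->]]].
    rewrite big_ord_recr /=; exists (\sum_(i < n) c (widen_ord (leqnSn n) i) *: e' i).
      by exists (fun i => c (widen_ord (leqnSn n) i)).
    by exists (c ord_max).
  exists (fun i => if unlift ord_max i is Some j then c j else a) => //.
  rewrite big_ord_recr /= unlift_none; congr (_ + _); apply: eq_bigr => i _.
  have -> : widen_ord (leqnSn n) i = lift ord_max i.
    by apply: val_inj; rewrite /= /bump leqNgt ltn_ord.
  by rewrite liftK /e'; congr (_ *: e _); apply: val_inj; rewrite /= /bump leqNgt ltn_ord.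
have S'l : linsub S'.
  split; first by exists (fun=> 0) => //; rewrite big1 // => i _; rewrite scale0r.
  move=> a _ _ [c _ <-] [c' _ <-]; exists (fun i => a * c i + c' i) => //.
  by rewrite scaler_sumr -big_split /=; apply: eq_bigr => i _; rewrite scalerDl scalerA.
have S'f : S' (fourier s e1).
  rewrite /fourier; elim: (s) (sS) => [|f t IHt] h.
    by rewrite big_nil; exact: S'l.1.
  rewrite big_cons; apply: S'l.2; first by apply: h; rewrite mem_head.
  by apply: IHt => g gt; apply: h; rewrite in_cons gt orbT.
have r_perp y : S' y -> dot y r = 0.
  by move=> Sy; rewrite /r dotBr -fourier_sym hs // subrr.
have er : dot e1 r = dot r r.
  have E : dot e1 r = dot (r + fourier s e1) r by rewrite subrK.
  by rewrite E (dotDl _ r) (r_perp _ S'f) addr0.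
have lf := fourier_linear s.
exists (r :: s).
  move=> f; rewrite in_cons => /orP[/eqP ->|fs]; apply/T'E.
    exists (- fourier s e1); first exact: linsubN.
    by exists 1; rewrite scale1r addrC.
  by exists f; [exact: sS|exists 0; rewrite scale0r addr0].
move=> x /T'E [y Sy [a ->]]; rewrite /fourier big_cons -/(fourier s _).
have -> : dot (y + a *: e1) r = a * dot r r.
  by rewrite (dotDl _ y) dotZl (r_perp _ Sy) add0r er.
have -> : fourier s (y + a *: e1) = a *: fourier s e1 + y by rewrite [y + _]addrC lf (hs _ Sy).
have -> : (a * dot r r / dot r r) *: r = a *: r.
  (* [r = 0] occurs when the spanning vectors are linearly dependent. *)
  have [->|r0] := eqVneq r 0; first by rewrite !scaler0.
  rewrite mulfK //; rewrite dotxx //; apply/eqP => /complexI/eqP.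
  by rewrite sqrf_eq0 => /eqP/nm_eq0/eqP; rewrite (negbTE r0).
by rewrite addrA -scalerDr subrK addrC.
Qed.

End projections.

(** * The inverse of L and the operator P *)

Section reduction.
Variables (R : realType) (X : completeNormedModType R[i]).
Variable dot : {dot X for Num.conj}.
Hypothesis hdot : dot_induces_norm dot.
Implicit Types (x y z : X).
Local Notation rd := (rd dot).
Local Notation perp := (perp dot).
Variable L : operator X.
Hypothesis L_sa : selfadjoint dot L.
Hypothesis L_ran : op_range L = perp (op_ker L).
Let kl := ker_linsub L_sa.
Let kc := ker_closed hdot L_sa.

Lemma Lplus_inv_eq x y : op_range L x -> dom L x -> L x = y -> Lplus_inv L y = x.
Proof.
move=> Rx Lx xy; apply: xget_unique => // z [Rz Lz zy].
rewrite L_ran in Rx Rz.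
apply/eqP; rewrite -subr_eq0; apply/eqP; apply: (perp_cap hdot (S := op_ker L)).
  split; first exact: (linsubB (sa_dom L_sa)).
  by rewrite (saB L_sa) // zy xy subrr.
exact: (linsubB (perp_linsub dot kl)).
Qed.

Lemma Lplus_invP y : op_range L y ->
  [/\ op_range L (Lplus_inv L y), dom L (Lplus_inv L y) & L (Lplus_inv L y) = y].
Proof.
move=> [x Lx <-]; have [k [kk pk Lk LE]] := sa_decomp hdot L_sa x.
have Rk : op_range L (x - k) by rewrite L_ran.
by rewrite (Lplus_inv_eq Rk (Lk Lx) (LE Lx)); split=> //; [exact: Lk|exact: LE].
Qed.

Lemma Lplus_invK x : dom L x -> Lplus_inv L (L x) = x - Pi_K dot L x.
Proof.
move=> Lx; have [Lk k0] := oproj_in hdot kl kc x; apply: Lplus_inv_eq.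
- by rewrite L_ran; exact: oproj_perp.
- exact: (linsubB (sa_dom L_sa)).
- by rewrite (saB L_sa) // k0 subr0.
Qed.

(* Extends [Lplus_inv L] by 0 on the kernel to a bounded operator on the whole space. *)
Definition Linv y : X := Lplus_inv L (y - Pi_K dot L y).

Lemma range_PiK y : op_range L (y - Pi_K dot L y).
Proof. by rewrite L_ran; exact: oproj_perp. Qed.

Lemma LinvE y : op_range L y -> Linv y = Lplus_inv L y.
Proof.
by rewrite L_ran /Linv /Pi_K => py; rewrite oproj_eq0 // subr0.
Qed.

Lemma Linv_linear : linear Linv.
Proof.
move=> a x y; have [Rx Dx Ex] := Lplus_invP (range_PiK x).
have [Ry Dy Ey] := Lplus_invP (range_PiK y).
apply: Lplus_inv_eq.
- by move: Rx Ry; rewrite L_ran; exact: (perp_linsub dot kl).2.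
- exact: (sa_dom L_sa).2.
rewrite (sa_lin L_sa) // Ex Ey /Pi_K oproj_linear // opprD addrACA scalerBr //.
Qed.

Lemma Linv_bounded (c : R) : 0 < c ->
  (forall x, dom L x -> perp (op_ker L) x -> c * nm x <= nm (L x)) ->
  forall y, nm (Linv y) <= c^-1 * nm y.
Proof.
move=> c0 hc y; have [Ry Dy Ey] := Lplus_invP (range_PiK y).
rewrite mulrC ler_pdivlMr // mulrC; apply: le_trans (hc _ Dy _) _.
  by rewrite -L_ran.
by rewrite Ey; exact: oproj_nm.
Qed.

Variable J : {linear X -> X}.
Hypothesis J_skew : forall x y, dot (J x) y = - dot x (J y).
Hypothesis K_fin : finite_dimensional (op_ker L).
Hypothesis JK : J @` op_ker L `<=` dom L.

(** For [f] in the kernel and [x] in [dom L], [<J (L x), f> = - <L x, J f> = - <x, L (J f)>], where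
    (III) puts [J f] in [dom L]. Expanding in a finite basis of the kernel gives a formula [Q] that
    makes sense and is bounded on all of [X]. *)
Lemma P_opP : exists2 M : R, 0 < M &
  [/\ linear (P_op dot J L), forall x, op_ker L (P_op dot J L x),
      forall x, nm (P_op dot J L x) <= M * nm x &
      forall x, dom L x -> P_op dot J L x = Pi_K dot L (J (L x))].
Proof.
have [s sK hs] := fourier_basis hdot K_fin.
pose Q x := - \sum_(f <- s) (dot x (L (J f)) / dot f f) *: f.
have linQ : linear Q.
  move=> a x y; rewrite /Q scalerN scaler_sumr -opprD -big_split /=; congr (- _).
  by apply: eq_bigr => f _; rewrite dotDl dotZl mulrDl scalerDl scalerA mulrA.
have QK x : op_ker L (Q x).
  rewrite /Q; apply: (linsubN kl).
  elim: (s) (sK) => [|f t IHt] h; first by rewrite big_nil; exact: kl.1.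
  rewrite big_cons; apply: kl.2; first by apply: h; rewrite mem_head.
  by apply: IHt => g gt; apply: h; rewrite in_cons gt orbT.
have [M M0 QM] : exists2 M : R, 0 < M & forall x, nm (Q x) <= M * nm x.
  rewrite /Q; elim: (s) => [|f t [M M0 IHt]].
    by exists 1 => // x; rewrite big_nil oppr0 nm0 mul1r nm_ge0.
  pose c := complex.Re `|(dot f f)^-1|.
  have c0 : 0 <= c by rewrite -ler0c RRe_real ?normr_real.
  exists (M + 2 * nm (L (J f)) * c * nm f).
    by rewrite ltr_wpDr // !mulr_ge0 // nm_ge0.
  move=> x; rewrite big_cons opprD; apply: le_trans (nmD _ _) _.
  rewrite nmN nmZc normrM.
  have -> : complex.Re (`|dot x (L (J f))| * `|(dot f f)^-1|) =
     complex.Re `|dot x (L (J f))| * c.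
    by rewrite normc_def [X in _ * X]normc_def -rmorphM /= /c normc_def.
  have := IHt x; have := dot_bound hdot x (L (J f)).
  have := nm_ge0 f; move: (nm _) (complex.Re _) => u v u0 h1.
  have h2 : v * c * u <= 2 * (nm x * nm (L (J f))) * c * u.
    by rewrite !ler_wpM2r.
  lra.
have QE x : dom L x -> Q x = Pi_K dot L (J (L x)).
  move=> Lx; rewrite -[RHS]hs; last exact: oproj_in.
  rewrite /Q /fourier -sumrN; apply: eq_big_seq => f fs.
  have [Lf f0] := sK f fs.
  have LJf : dom L (J f) by apply: JK; exists f.
  rewrite -scaleNr -mulNr; congr ((_ / _) *: _).
  rewrite -(sa_sym L_sa) // -J_skew.
  have p := @oproj_perp _ _ _ hdot _ kl kc (J (L x)).
  have := dot_eq0 kl p (sK f fs); rewrite dotBl => /eqP.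
  by rewrite subr_eq0 => /eqP.
have -> : P_op dot J L = Q; last by exists M.
apply: xget_unique.
  (* [L] vanishes on the values of [Q], so their graph norm is the norm. *)
  split=> //; exists M => x; split; first by case: (QK x).
  case: (QK x) => _ Q0; rewrite /graph_norm Q0 normr0 add0r !nmE -rmorphM lecR.
  exact: QM.
move=> Q' [lQ' [N hN] Q'E]; apply: funext => x; apply/eqP; rewrite -subr_eq0; apply/eqP.
have Q'N y : nm (Q' y) <= N * nm y.
  have [_ h] := hN y; rewrite -lecR rmorphM /= -!nmE; apply: le_trans h.
  by rewrite /graph_norm lerDr.
apply: nm_small => e e0.
(* Any other bounded extension agrees with [Q] on the dense set [dom L]. *)
have [|u Lu xu] := sa_dense L_sa x (e := e / (`|N| + M)).
  by rewrite divr_gt0 // ltr_wpDl.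
have dif (f : X -> X) y z : linear f -> f y - f z = f (y - z).
  by move=> lf; rewrite addrC -scaleN1r -lf scaleN1r addrC.
have -> : Q' x - Q x = Q' (x - u) - Q (x - u).
  by rewrite -(dif Q' x u lQ') -(dif Q x u linQ) (Q'E _ Lu) (QE _ Lu) opprB addrA subrK.
apply: le_trans (nmB _ _) _.
have h1 := Q'N (x - u); have h2 := QM (x - u).
have h3 : N * nm (x - u) <= `|N| * nm (x - u) by rewrite ler_wpM2r ?nm_ge0 ?ler_norm.
move: xu; rewrite ltr_pdivlMr; last by rewrite ltr_wpDl.
lra.
Qed.

End reduction.

(** * Projection-valued measures *)

Section projection_valued_measure.
Variables (R : realType) (X : completeNormedModType R[i]).
Variable dot : {dot X for Num.conj}.
Hypothesis hdot : dot_induces_norm dot.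
Implicit Types (x y z : X) (A B D : set R).
Local Notation rd := (rd dot).
Local Notation perp := (perp dot).
Variable E : set R -> X -> X.
Hypothesis hE : projection_measure dot E.

Lemma pvm_linear A : measurable A -> linear (E A).
Proof. by case: hE => h _ _ /h[]. Qed.

Lemma pvm_idem A x : measurable A -> E A (E A x) = E A x.
Proof. by case: hE => h _ _ /h[_ ->]. Qed.

Lemma pvm_sym A x y : measurable A -> rd (E A x) y = rd x (E A y).
Proof. by case: hE => h _ _ /h[_ _ s]; rewrite /rd s. Qed.

Lemma pvmT x : E setT x = x.
Proof. by case: hE. Qed.

Section additivity.
Variables (A : set R) (mA : measurable A).

Lemma pvm0 : E A 0 = 0.
Proof. exact: linear_map0 (pvm_linear mA). Qed.

Lemma pvmD x y : E A (x + y) = E A x + E A y.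
Proof. by have := pvm_linear mA 1 x y; rewrite !scale1r. Qed.

Lemma pvmZ a x : E A (a *: x) = a *: E A x.
Proof. by have := pvm_linear mA a x 0; rewrite pvm0 !addr0. Qed.

Lemma pvmB x y : E A (x - y) = E A x - E A y.
Proof. by rewrite pvmD -scaleN1r pvmZ scaleN1r. Qed.

Lemma pvm_sum (I : Type) (s : seq I) (F : I -> X) :
  E A (\sum_(i <- s) F i) = \sum_(i <- s) E A (F i).
Proof. by elim: s => [|i s IH]; rewrite ?big_nil ?pvm0 // !big_cons pvmD IH. Qed.

Lemma pvm_sqr x : nm (E A x) ^+ 2 = rd (E A x) x.
Proof. by rewrite -(rdxx hdot) -pvm_sym // pvm_idem. Qed.

Lemma pvm_le x : nm (E A x) <= nm x.
Proof.
have := rd_le hdot (E A x) x; rewrite -pvm_sqr expr2.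
have [->|a0] := eqVneq (nm (E A x)) 0; first by rewrite nm_ge0.
by rewrite ler_pM2l // lt_neqAle eq_sym a0 nm_ge0.
Qed.

End additivity.

Lemma pvm_cvg (F : nat -> set R) x : (forall n, measurable (F n)) -> trivIset setT F ->
  forall e : R, 0 < e -> exists N, forall n, (N <= n)%N ->
    nm (E (\bigcup_n F n) x - \sum_(i < n) E (F i) x) < e.
Proof.
case: hE => _ _ h mF tF e e0; have /cvg_nm/(_ e e0)[N _ hN] := h F x mF tF.
by exists N => n; exact: hN.
Qed.

(** In the convergent series for a sequence of empty sets all terms equal [E set0 x], so this term
    is as small as the difference of two late partial sums. *)
Lemma pvm_set0 x : E set0 x = 0.
Proof.
apply: nm_small => e e0; have e2 : 0 < e / 2 by rewrite divr_gt0.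
have tF : trivIset setT (fun _ : nat => set0 : set R).
  by move=> i j _ _ [t []].
have [N hN] := pvm_cvg x (fun _ => @measurable0 _ R) tF e2.
have h1 := hN N (leqnn _); have h2 := hN N.+1 (leqnSn _).
rewrite big_ord_recr /= in h2.
move: h1 h2; set s := \sum_(i < N) _; set b := E (\bigcup_ _ _) x.
rewrite opprD addrA => h1 h2.
have := nmB (b - s) (b - s - E set0 x); rewrite subKr => h3.
by apply: le_trans h3 _; apply: ltW; rewrite [e]splitr ltrD.
Qed.

Lemma pvmU A B x : measurable A -> measurable B -> A `&` B = set0 ->
  E (A `|` B) x = E A x + E B x.
Proof.
move=> mA mB AB0; apply/eqP; rewrite -subr_eq0; apply/eqP/nm_small => e e0.
have mF n : measurable (bigcup2 A B n).
  by case: n => [|[|n]] //=; exact: measurable0.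
have tF : trivIset setT (bigcup2 A B) by rewrite -trivIset_bigcup2.
have [N hN] := pvm_cvg x mF tF e0; rewrite bigcup2E in hN.
apply: ltW; have := hN N.+2 (leq_trans (leqnSn _) (leqnSn _)).
rewrite 2!big_ord_recl /= big1 ?addr0 // => i _; exact: pvm_set0.
Qed.

(** Multiplicativity is derived from additivity: for [y] in the range of [E B], the norm of
    [E A y + y = E (A U B) y] has square [|E A y| ^ 2 + |y| ^ 2] but is at most [|y|]. *)
Lemma pvm_disjoint A B x : measurable A -> measurable B -> A `&` B = set0 ->
  E A (E B x) = 0.
Proof.
move=> mA mB AB0; set y := E B x.
have mU := measurableU _ _ mA mB.
have := pvm_sqr mU y; rewrite pvmU // rdDl -!pvm_sqr //.
have -> : E B y = y by rewrite pvm_idem.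
move=> h; have : nm (E A y + y) <= nm y.
  by have := pvm_le mU y; rewrite pvmU // [E B y]pvm_idem.
rewrite -(ler_pXn2r (n := 2)) ?nnegrE ?nm_ge0 // h gerDr => h2.
by apply/nm_eq0/eqP; rewrite -sqrf_eq0 eq_le h2 sqr_ge0.
Qed.

Lemma pvm_split A B x : measurable A -> measurable B ->
  E A x = E (A `&` B) x + E (A `\` B) x.
Proof.
move=> mA mB; rewrite -pvmU ?setUIDK //.
- exact: measurableI.
- exact: measurableD.
- by apply/seteqP; split=> // t [[_ tB] [_]].
Qed.

Lemma pvmI A B x : measurable A -> measurable B -> E A (E B x) = E (A `&` B) x.
Proof.
move=> mA mB; have mI := measurableI _ _ mA mB.
have mD1 := measurableD mA mB; have mD2 := measurableD mB mA.
rewrite (pvm_split x mB mA) (setIC B) (pvmD mA).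
have -> : E A (E (B `\` A) x) = 0.
  by apply: pvm_disjoint => //; apply/seteqP; split=> // t [tA [_]].
rewrite addr0 (pvm_split _ mA mB) pvm_idem //.
have -> : E (A `\` B) (E (A `&` B) x) = 0; last by rewrite addr0.
by apply: pvm_disjoint => //; apply/seteqP; split=> // t [[_ tB] [_]].
Qed.

Lemma pvm_sub A B x : measurable A -> measurable B -> A `<=` B ->
  E A (E B x) = E A x /\ E B (E A x) = E A x.
Proof. by move=> mA mB AB; rewrite !pvmI // (setIidl AB) (setIidr AB). Qed.

Lemma pvm_mono A B x : measurable A -> measurable B -> A `<=` B ->
  nm (E A x) <= nm (E B x).
Proof. by move=> mA mB AB; rewrite -(pvm_sub x mA mB AB).1; exact: pvm_le. Qed.

Lemma pvm_setD A B x : measurable A -> measurable B -> A `<=` B ->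
  E B x - E A x = E (B `\` A) x.
Proof.
by move=> mA mB AB; rewrite (pvm_split x mB mA) (setIidr AB) addrC addKr.
Qed.

Lemma pvm_bigcup_seq (I : choiceType) (A : I -> set R) (s : seq I) x :
  (forall i, measurable (A i)) -> trivIset setT A -> uniq s ->
  \sum_(i <- s) E (A i) x = E (\bigcup_(i in [set` s]) A i) x.
Proof.
move=> mA tA; elim: s => [|i s IH] us.
  by rewrite big_nil set_nil bigcup_set0 pvm_set0.
move: us; rewrite big_cons /= => /andP[is_ us]; rewrite IH //.
have -> : [set` i :: s] = i |` [set` s].
  apply/seteqP; split=> j /=; rewrite in_cons; first by move=> /orP[/eqP|]; [left|right].
  by move=> [->|->]; rewrite ?eqxx ?orbT.
rewrite bigcup_setU1 pvmU //.
  by rewrite bigcup_seq; exact: bigsetU_measurable.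
apply/seteqP; split=> [t [Ait [j js Ajt]]|] //.
have ij : i = j by apply: (tA i j) => //; exists t.
by move: js; rewrite /= -ij (negbTE is_).
Qed.

Lemma rd_suml (I : Type) (s : seq I) (F : I -> X) y :
  rd (\sum_(i <- s) F i) y = \sum_(i <- s) rd (F i) y.
Proof. by elim: s => [|i s IH]; rewrite ?big_nil ?rd0l // !big_cons rdDl IH. Qed.

Lemma pvm_bigcup n (A : 'I_n -> set R) x :
  (forall i, measurable (A i)) -> trivIset setT A ->
  \sum_(i < n) E (A i) x = E (\bigcup_i A i) x.
Proof.
move=> mA tA; rewrite -[LHS]big_enum /= pvm_bigcup_seq ?enum_uniq //.
congr (E _ x); apply: eq_bigcupl; split=> // i _ /=.
by rewrite mem_enum.
Qed.

(** Estimates made cell by cell add up through this identity, which does the work of the scalar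
    measures [|E A y| ^ 2]. *)
Lemma pvm_pythagoras n (A : 'I_n -> set R) (v : 'I_n -> X) :
  (forall i, measurable (A i)) -> trivIset setT A ->
  nm (\sum_(i < n) E (A i) (v i)) ^+ 2 = \sum_(i < n) nm (E (A i) (v i)) ^+ 2.
Proof.
move=> mA tA; rewrite -(rdxx hdot) rd_suml; apply: eq_bigr => i _.
rewrite rdC rd_suml (bigD1 i) //= (rdxx hdot) big1 ?addr0 // => j ji.
rewrite pvm_sym // pvm_disjoint ?rd0r //.
apply: contrapT => /eqP/set0P[t ht]; move/eqP: ji; apply.
by apply: (tA j i) => //; exists t.
Qed.

Lemma pvm_null (F : nat -> set R) : (forall n, measurable (F n)) ->
  (forall n x, E (F n) x = 0) -> forall x, E (\bigcup_n F n) x = 0.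
Proof.
move=> mF F0 x; apply: nm_small => e e0.
have mS n : measurable (seqDU F n) by exact: seqDU_measurable.
have S0 n : E (seqDU F n) x = 0.
  by rewrite -(pvm_sub x (mS n) (mF n) (@subset_seqDU _ F n)).1 F0 pvm0.
have [N hN] := pvm_cvg x mS (@trivIset_seqDU _ F) e0.
have := hN N (leqnn _); rewrite -seqDU_bigcup_eq big1 ?subr0 => [/ltW//|i _].
exact: S0.
Qed.

(** Countable additivity over the disjointified intervals [[-n, n]] gives one good [n]; monotonicity
    extends the bound to all larger [[a, b]], as the independent limits in [is_sint] require. *)
Lemma pvm_exhaust D x : measurable D -> forall e : R, 0 < e ->
  exists N : R, forall a b, a <= - N -> N <= b ->
    nm (E D x - E (D `&` `[a, b]) x) < e.
Proof.
move=> mD e e0; pose F (n : nat) : set R := [set` `[- n%:R, n%:R]].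
have mF n : measurable (F n) by exact: measurable_itv.
have mS n : measurable (seqDU F n) by exact: seqDU_measurable.
have FT : \bigcup_n F n = setT.
  apply/seteqP; split=> // t _; exists (Num.bound `|t|) => //.
  by rewrite /F /mkset (@in_itv _ R) /= -ler_norml ltW // archi_boundP.
have [n hn] := pvm_cvg x mS (@trivIset_seqDU _ F) e0.
have {hn} := hn n (leqnn _); rewrite -seqDU_bigcup_eq FT pvmT.
have tS : trivIset [set: 'I_n] (fun i => seqDU F i).
  by move=> i j _ _ ij; apply/ord_inj; exact: (@trivIset_seqDU _ F) ij.
rewrite (pvm_bigcup x (fun i : 'I_n => mS i) tS).
set U := \bigcup_ _ _ => hU.
have mU : measurable U by apply: fin_bigcup_measurable.
exists n%:R => a b an nb.
have UF : U `<=` `[a, b].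
  move=> t [i _ Si]; have := @subset_seqDU _ F i t Si.
  rewrite /F /mkset !(@in_itv _ R) /= => /andP[h1 h2].
  have : i%:R <= n%:R :> R by rewrite ler_nat ltnW.
  by move=> h; apply/andP; split; lra.
have mI : measurable (D `&` `[a, b]) by apply: measurableI => //; exact: measurable_itv.
have sD : D `&` `[a, b] `<=` D by move=> t [].
rewrite pvm_setD //.
have mDI := measurableD mD mI.
apply: le_lt_trans hU; rewrite -{2}[x]pvmT pvm_setD //.
apply: pvm_mono => //; first exact: measurableD.
by move=> t [Dt nDt]; split=> // Ut; apply: nDt; split=> //; exact: UF.
Qed.

End projection_valued_measure.

(** * Spectral integrals *)

Section spectral_integrals.
Variables (R : realType) (X : completeNormedModType R[i]).
Variable dot : {dot X for Num.conj}.
Hypothesis hdot : dot_induces_norm dot.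
Implicit Types (x y z : X) (A B D : set R).
Local Notation rd := (rd dot).
Local Notation perp := (perp dot).
Variable E : set R -> X -> X.
Hypothesis hE : projection_measure dot E.

Lemma measurable_cc (a b : R) : measurable `[a, b].
Proof. exact: measurable_itv. Qed.

Lemma measurable_Icc D (a b : R) : measurable D -> measurable (D `&` `[a, b]).
Proof. by move=> mD; apply: measurableI => //; exact: measurable_cc. Qed.

Lemma is_sintE D (k : R -> X -> X) y z :
  is_sint E D k y z <-> exists2 I : R -> R -> X,
    forall a b, is_RSint E (D `&` `[a, b]) k y (I a b) &
    forall e : R, 0 < e -> exists N : R, forall a b, a <= - N -> N <= b -> nm (z - I a b) < e.
Proof.
have FF : ProperFilter (filter_prod (ninfty_nbhs R) (pinfty_nbhs R)).
  exact: filter_prod_proper.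
split=> [[I [hI /cvg_nm cI]]|[I hI cI]]; exists I => //.
  move=> e /cI [[P Q] /= [[M [_ hM]] [N [_ hN]]] h].
  exists (Num.max (1 - M) (N + 1)) => a b ha hb.
  apply: (h (a, b)); split; [apply: hM|apply: hN].
    have : 1 - M <= Num.max (1 - M) (N + 1) by rewrite le_max lexx.
    by move=> /= *; lra.
  have : N + 1 <= Num.max (1 - M) (N + 1) by rewrite le_max lexx orbT.
  by move=> /= *; lra.
split=> //; apply/cvg_nm => e /cI [N hN].
exists ([set a | a < - N], [set b | N < b]) => /=.
  by split; [exists (- N)|exists N]; split=> //; exact: num_real.
by move=> [a b] [/= /ltW ha /ltW hb]; exact: hN.
Qed.

(** Without fine partitions [is_RSint] would hold vacuously and integrals would not be unique. *)
Lemma tagged_partition_exists D (eta a b : R) : measurable D -> 0 < eta ->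
  D `<=` `[a, b] ->
  exists n (A : 'I_n -> set R) (t : 'I_n -> R), tagged_partition D eta A t.
Proof.
move=> mD eta0 Dab.
pose N := (Num.bound ((b - a) / eta)).+1.
pose C (j : 'I_N) : set R := D `&` `[a + j%:R * eta, a + j.+1%:R * eta[.
(* Only nonempty cells are kept, since each cell must contain its tag. *)
pose S := [set j | `[< C j !=set0 >]].
have tag (i : 'I_#|S|) : exists t, C (enum_val i) t.
  by have := enum_valP i; rewrite inE => /asboolP.
have [t ht] := choice tag.
have CE j r : C j r -> [/\ D r, a + j%:R * eta <= r & r < a + j.+1%:R * eta].
  by move=> [Dr]; rewrite /mkset (@in_itv _ R) /= => /andP[].
exists #|S|, (fun i => C (enum_val i)), t; split=> //.
- by move=> i; apply: measurableI => //; exact: measurable_itv.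
- move=> i j _ _ [r [/CE[_ i1 i2] /CE[_ j1 j2]]]; apply/enum_val_inj/ord_inj.
  have lt (p q : nat) : p%:R * eta < q.+1%:R * eta -> (p <= q)%N.
    by rewrite ltr_pM2r // ltr_nat.
  by apply/anti_leq/andP; split; apply: lt; lra.
- apply/seteqP; split=> [r [i _ /CE[]]//|r Dr].
  have := Dab r Dr; rewrite /mkset (@in_itv _ R) /= => /andP[ar rb].
  have ra0 : 0 <= (r - a) / eta by rewrite divr_ge0 ?subr_ge0 // ltW.
  pose j := Num.trunc ((r - a) / eta).
  have /andP[j1 j2] := trunc_itv ra0; rewrite -/j in j1 j2.
  rewrite ler_pdivlMr // in j1; rewrite ltr_pdivrMr // in j2.
  have jN : (j < N)%N.
    rewrite ltnS -(ler_nat R); apply: ltW; apply: le_lt_trans (archi_boundP _).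
      by rewrite ler_pdivlMr // (le_trans j1) //; lra.
    by rewrite divr_ge0 ?subr_ge0 ?(le_trans ar) // ltW.
  have Cr : C (Ordinal jN) r.
    by split=> //; rewrite /mkset (@in_itv _ R) /=; apply/andP; split; lra.
  have jS : Ordinal jN \in S by rewrite inE; apply/asboolP; exists r.
  by exists (enum_rank_in jS (Ordinal jN)) => //; rewrite enum_rankK_in.
- move=> i r s /CE[_ r1 r2] /CE[_ s1 s2].
  rewrite -natr1 mulrDl mul1r in r2 s2.
  by rewrite ler_norml; apply/andP; split; lra.
Qed.

Lemma sint_unique D (k : R -> X -> X) y z z' : measurable D ->
  is_sint E D k y z -> is_sint E D k y z' -> z = z'.
Proof.
move=> mD /is_sintE[I hI cI] /is_sintE[I' hI' cI'].
have II' a b : I a b = I' a b.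
  apply/eqP; rewrite -subr_eq0; apply/eqP/nm_small => e e0.
  have e2 : 0 < e / 2 by rewrite divr_gt0.
  have [d d0 hd] := hI a b _ e2; have [d' d'0 hd'] := hI' a b _ e2.
  have dm : 0 < Num.min d d' by rewrite lt_min d0.
  have [n [A [t [h1 h2 h3 h4 h5]]]] := tagged_partition_exists
    (measurable_Icc a b mD) dm (@subIsetr _ _ _).
  have /hd : tagged_partition (D `&` `[a, b]) d A t.
    by split=> // i r s ri si; apply: le_trans (h5 i r s ri si) _; rewrite ge_min lexx.
  have /hd' : tagged_partition (D `&` `[a, b]) d' A t.
    by split=> // i r s ri si; apply: le_trans (h5 i r s ri si) _; rewrite ge_min lexx orbT.
  rewrite !nmE !ltcR => g1 g2.
  have := nm_tri (\sum_(i < n) k (t i) (E (A i) y)) (I a b) (I' a b).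
  rewrite (nmBC (I a b) (\sum_(i < n) _)); lra.
apply/eqP; rewrite -subr_eq0; apply/eqP/nm_small => e e0.
have e2 : 0 < e / 2 by rewrite divr_gt0.
have [N hN] := cI _ e2; have [N' hN'] := cI' _ e2.
pose M := Num.max N N'.
have NM : N <= M by rewrite le_max lexx.
have N'M : N' <= M by rewrite le_max lexx orbT.
have := nm_tri (I (- M) M) z z'.
have h1 : nm (z - I (- M) M) < e / 2 by apply: hN; lra.
have h2 : nm (z' - I (- M) M) < e / 2 by rewrite II'; apply: hN'; lra.
rewrite (nmBC (I _ _) z'); lra.
Qed.

Lemma sint_eq D (k : R -> X -> X) y z : measurable D ->
  is_sint E D k y z -> sint E D k y = z.
Proof. by move=> mD h; apply: xget_unique => // z' h'; exact: sint_unique h' h. Qed.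

Definition bounded_op (T : X -> X) :=
  linear T /\ exists2 M : R, 0 < M & forall x, nm (T x) <= M * nm x.

(* [phi] is integrable over bounded parts of [D] against [dE y], with integral
   [E (D `&` `[a, b]) u]. *)
Definition loc_int D (phi : R -> R) y u := forall a b,
  is_RSint E (D `&` `[a, b]) (fun w v => (phi w)%:C%C *: v) y (E (D `&` `[a, b]) u).

(** Both operator-valued kernels split into two bounded operators times scalar functions, and
    bounded operators pass through Riemann sums and limits. The splitting is asked only on vectors
    [E A y] with [A] inside [D], since [Lplus_inv] has no meaning off the range of [L]. *)
Lemma sint_intro D (k : R -> X -> X) (T1 T2 : X -> X) (phi1 phi2 : R -> R) y u1 u2 :
  measurable D -> bounded_op T1 -> bounded_op T2 ->
  loc_int D phi1 y u1 -> loc_int D phi2 y u2 ->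
  (forall w A, D w -> measurable A -> A `<=` D ->
    k w (E A y) = T1 ((phi1 w)%:C%C *: E A y) + T2 ((phi2 w)%:C%C *: E A y)) ->
  is_sint E D k y (T1 (E D u1) + T2 (E D u2)).
Proof.
move=> mD [l1 [M1 M10 b1]] [l2 [M2 M20 b2]] i1 i2 hk.
have dif (f : X -> X) p q : linear f -> f p - f q = f (p - q).
  by move=> lf; rewrite addrC -scaleN1r -lf scaleN1r addrC.
have key (p1 p2 q1 q2 : X) (e : R) : 0 < e ->
    nm (p1 - q1) < e / (M1 + M2) -> nm (p2 - q2) < e / (M1 + M2) ->
    nm (T1 p1 + T2 p2 - (T1 q1 + T2 q2)) < e.
  move=> e0; rewrite !ltr_pdivlMr ?addr_gt0 // opprD addrACA !dif // => h1 h2.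
  apply: le_lt_trans (nmD _ _) _.
  have := b1 (p1 - q1); have := b2 (p2 - q2).
  have := nm_ge0 (p1 - q1); have := nm_ge0 (p2 - q2); move: h1 h2.
  move: (nm (p1 - q1)) (nm (p2 - q2)) (nm (T1 _)) (nm (T2 _)) => a b c d *.
  nra.
have sumf (f : X -> X) n (F : 'I_n -> X) : linear f ->
    \sum_(i < n) f (F i) = f (\sum_(i < n) F i).
  move=> lf; apply: (big_rec2 (fun u v => u = f v)); first by rewrite linear_map0.
  by move=> i u v _ ->; have := lf 1 (F i) v; rewrite !scale1r.
apply/is_sintE; exists (fun a b => T1 (E (D `&` `[a, b]) u1) + T2 (E (D `&` `[a, b]) u2)).
  move=> a b e e0; have e1 : 0 < e / (M1 + M2) by rewrite divr_gt0 // addr_gt0.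
  have [d1 d10 h1] := i1 a b _ e1; have [d2 d20 h2] := i2 a b _ e1.
  exists (Num.min d1 d2); first by rewrite lt_min d10.
  move=> n A t [p1 p2 p3 p4 p5].
  have AD i r : A i r -> D r.
    by move=> Air; have : (\bigcup_i A i) r; [exists i|rewrite p3 => -[]].
  have -> : \sum_(i < n) k (t i) (E (A i) y) =
      T1 (\sum_(i < n) (phi1 (t i))%:C%C *: E (A i) y)
    + T2 (\sum_(i < n) (phi2 (t i))%:C%C *: E (A i) y).
    rewrite -(sumf T1) // -(sumf T2) // -big_split /=; apply: eq_bigr => i _; apply: hk => //.
      by apply: AD; exact: p4.
    by move=> r; exact: AD.
  rewrite nmE ltcR; apply: key => //.
    have := h1 n A t; rewrite nmE ltcR; apply; split=> // i r s ri si.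
    by apply: le_trans (p5 i r s ri si) _; rewrite ge_min lexx.
  have := h2 n A t; rewrite nmE ltcR; apply; split=> // i r s ri si.
  by apply: le_trans (p5 i r s ri si) _; rewrite ge_min lexx orbT.
move=> e e0; have e1 : 0 < e / (M1 + M2) by rewrite divr_gt0 // addr_gt0.
have [N1 h1] := pvm_exhaust hdot hE u1 mD e1; have [N2 h2] := pvm_exhaust hdot hE u2 mD e1.
exists (Num.max N1 N2) => a b ha hb.
have m1 : N1 <= Num.max N1 N2 by rewrite le_max lexx.
have m2 : N2 <= Num.max N1 N2 by rewrite le_max lexx orbT.
by apply: key => //; [apply: h1; lra|apply: h2; lra].
Qed.

Lemma loc_int1 D y : measurable D -> loc_int D (fun=> 1) y y.
Proof.
move=> mD a b e e0; exists 1 => // n A t [p1 p2 p3 p4 p5].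
under eq_bigr do rewrite scale1r.
by rewrite (pvm_bigcup hE) // p3 subrr normr0 ltcR.
Qed.

End spectral_integrals.

(** * Spectral families *)

Section spectral_families.
Variables (R : realType) (X : completeNormedModType R[i]).
Variable dot : {dot X for Num.conj}.
Hypothesis hdot : dot_induces_norm dot.
Implicit Types (x y z g : X) (A B D : set R).
Local Notation rd := (rd dot).
Local Notation perp := (perp dot).
Variable E : set R -> X -> X.
Variable H : operator X.
Hypothesis H_sa : selfadjoint dot H.
Hypothesis hEH : spectral_family dot H E.
Let hE : projection_measure dot E. Proof. by case: hEH. Qed.
Let idE := pvm_idem hE.

(** [E A] commutes with every Riemann sum, so the integral for [E A g] converges to [E A (H g)]; the
    domain of [H] being all vectors of convergence, [E A g] lies in it. *)
Lemma pvm_reduces A g : measurable A -> dom H g ->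
  dom H (E A g) /\ H (E A g) = E A (H g).
Proof.
move=> mA Hg; case: hEH => _ hH; apply/hH/is_sintE.
have /is_sintE[I hI cI] := (hH g (H g)).1 (conj Hg erefl).
have le x y (e : R) : nm (x - y) < e -> nm (E A x - E A y) < e.
  by move=> xy; rewrite -(pvmB hE mA); apply: le_lt_trans xy; exact: pvm_le.
exists (fun a b => E A (I a b)) => [a b e e0|e /cI[N hN]]; last first.
  by exists N => a b ha hb; apply/le/hN.
have [d d0 hd] := hI a b e e0; exists d => // n B t pt.
have [p1 _ _ _ _] := pt.
have -> : \sum_(i < n) (t i)%:C%C *: E (B i) (E A g)
    = E A (\sum_(i < n) (t i)%:C%C *: E (B i) g).
  rewrite (pvm_sum hE mA); apply: eq_bigr => i _.
  by rewrite (pvmZ hE mA) !(pvmI hdot hE) // setIC.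
by have := hd n B t pt; rewrite !nmE !ltcR; exact: le.
Qed.

Lemma pvm_localizes A g (s eta : R) : measurable A -> dom H g -> 0 <= eta ->
  (forall r, A r -> `|r - s| <= eta) ->
  nm (E A (H g - s%:C%C *: g)) <= eta * nm (E A g).
Proof.
move=> mA Hg eta0 As; have [Hg' HE] := pvm_reduces mA Hg.
rewrite (pvmB hE mA) (pvmZ hE mA) -HE; set g' := E A g.
have g'0 := nm_ge0 g'.
case: (hEH) => _ hH; have /is_sintE[I hI cI] := (hH g' (H g')).1 (conj Hg' erefl).
suff key (e : R) : 0 < e -> nm (H g' - s%:C%C *: g') <= eta * nm g' + e * (2 + nm g').
  apply/ler_addgt0Pr.
  change (forall e : R, 0 < e -> nm (H g' - s%:C%C *: g') <= eta * nm g' + e) => e e0.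
  have := key (e / (2 + nm g')); rewrite divfK; last by apply/lt0r_neq0; lra.
  by apply; rewrite divr_gt0 //; lra.
move=> e0; have [N hN] := cI _ e0.
(* The interval is long enough for the truncation error and contains [A]. *)
pose a := Num.min (- N) (s - eta); pose b := Num.max N (s + eta).
have h1 : nm (H g' - I a b) < e.
  by apply: hN; rewrite ?ge_min ?le_max lexx.
have [d d0 hd] := hI a b e e0.
have dm : 0 < Num.min d e by rewrite lt_min d0.
have [n [B [t [p1 p2 p3 p4 p5]]]] := tagged_partition_exists
  (measurable_Icc a b measurableT) dm (@subIsetr _ _ _).
have pt : tagged_partition (setT `&` `[a, b]) d B t.
  by split=> // i r r' ri r'i; apply: le_trans (p5 i r r' ri r'i) _; rewrite ge_min lexx.
have := hd n B t pt; rewrite nmE ltcR => h2.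
have Aab : A `<=` setT `&` `[a, b].
  move=> r /As; rewrite ler_norml => /andP[r1 r2]; split=> //.
  rewrite /mkset (@in_itv _ R) /= /a /b; apply/andP; split.
    by rewrite ge_min; apply/orP; right; lra.
  by rewrite le_max; apply/orP; right; lra.
have sg : \sum_(i < n) E (B i) g' = g'.
  rewrite (pvm_bigcup hE) // p3; apply: (pvm_sub hdot hE _ mA _ Aab).2.
  exact: measurable_Icc.
have h3 : nm (\sum_(i < n) (t i)%:C%C *: E (B i) g' - s%:C%C *: g') <= (eta + e) * nm g'.
  rewrite -{2}sg scaler_sumr -sumrB.
  under eq_bigr do rewrite -scalerBl -rmorphB /= -(pvmZ hE (p1 _)).
  have ee : 0 <= eta + e by lra.
  rewrite -(ler_pXn2r (n := 2)) ?nnegrE ?nm_ge0 ?mulr_ge0 //.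
  rewrite (pvm_pythagoras hdot hE) // exprMn -{2}sg (pvm_pythagoras hdot hE) // mulr_sumr.
  apply: ler_sum => i _; rewrite (pvmZ hE (p1 i)) nmZ exprMn.
  (* A cell meeting [A] has its tag within [eta + e] of [s]; any other cell annihilates
     [g' = E A g]. *)
  have [[r [Br Ar]]|nBA] := pselect (B i `&` A !=set0).
    rewrite ler_wpM2r ?sqr_ge0 // ler_pXn2r ?nnegrE //.
    have := p5 i _ _ (p4 i) Br; rewrite le_min => /andP[_ h4].
    have := As r Ar; have := ler_distD r (t i) s; lra.
  have -> : E (B i) g' = 0; last by rewrite nm0 expr0n /= !mulr0.
  rewrite (pvm_disjoint hdot hE) //; apply: contrapT => /eqP/set0P; exact: nBA.
have := nm_tri (I a b) (H g') (s%:C%C *: g').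
have := nm_tri (\sum_(i < n) (t i)%:C%C *: E (B i) g') (I a b) (s%:C%C *: g').
rewrite (nmBC (I a b) (\sum_(i < n) _)).
lra.
Qed.

(** Each cell lies within [eta] of its own tag, so [pvm_localizes] applies with [s = t i], and
    Pythagoras sums the errors. Used with [phi = 1] and with [phi w = 1 / w]. *)
Lemma pvm_riemann_sum D (eta c : R) n (A : 'I_n -> set R) (t : 'I_n -> R) (phi : R -> R) g :
  dom H g -> tagged_partition D eta A t -> 0 < eta -> 0 <= c ->
  (forall i, `|phi (t i)| <= c) ->
  nm (\sum_(i < n) (phi (t i))%:C%C *: E (A i) (H g - (t i)%:C%C *: g)) <= c * eta * nm g.
Proof.
move=> Hg [p1 p2 p3 p4 p5] eta0 c0 hc.
under eq_bigr do rewrite -(pvmZ hE (p1 _)).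
have ee : 0 <= c * eta by rewrite mulr_ge0 // ltW.
rewrite -(ler_pXn2r (n := 2)) ?nnegrE ?nm_ge0 ?mulr_ge0 ?nm_ge0 //.
rewrite (pvm_pythagoras hdot hE) // exprMn.
have : nm (\sum_(i < n) E (A i) g) ^+ 2 <= nm g ^+ 2.
  rewrite (pvm_bigcup hE) // ler_pXn2r ?nnegrE ?nm_ge0 //; apply: pvm_le => //.
  by apply: fin_bigcup_measurable.
rewrite (pvm_pythagoras hdot hE) // => h.
apply: le_trans (ler_wpM2l (sqr_ge0 (c * eta)) h); rewrite mulr_sumr.
apply: ler_sum => i _; rewrite (pvmZ hE (p1 i)) nmZ !exprMn -[X in _ <= X]mulrA.
have le0 := ltW eta0.
apply: ler_pM; rewrite ?sqr_ge0 //; first by rewrite ler_pXn2r ?nnegrE.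
rewrite -exprMn ler_pXn2r ?nnegrE ?nm_ge0 ?mulr_ge0 ?nm_ge0 //.
apply: pvm_localizes => // r Ar.
  by rewrite distrC; apply: (p5 i).
exact: ltW.
Qed.

Lemma small_mesh (e c y : R) : 0 < e -> 0 <= c -> 0 <= y ->
  exists2 eta : R, 0 < eta & c * eta * y < e.
Proof.
move=> e0 c0 y0; exists (e / (c * y + 1)).
  by rewrite divr_gt0 // ltr_wpDl // mulr_ge0.
have cy : 0 <= c * y by rewrite mulr_ge0.
rewrite mulrAC mulrA ltr_pdivrMr; last lra.
nra.
Qed.

Lemma loc_int_id D g : measurable D -> dom H g -> loc_int E D (fun w => w) g (H g).
Proof.
move=> mD Hg a b e e0; have [eta eta0 he] := small_mesh e0 ler01 (nm_ge0 g).
exists eta => // n A t pt; have [p1 p2 p3 p4 p5] := pt.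
rewrite nmE ltcR nmBC; apply: le_lt_trans he.
have := pvm_riemann_sum (c := 1) (phi := fun=> 1) Hg pt eta0 ler01.
rewrite normr1 => /(_ (fun=> lexx _)); congr (nm _ <= _).
under eq_bigr do rewrite scale1r (pvmB hE (p1 _)) (pvmZ hE (p1 _)).
by rewrite sumrB (pvm_bigcup hE) // p3.
Qed.

Variable eps : R.
Hypothesis eps_gt0 : 0 < eps.
Local Notation D := (outer eps).

Lemma measurable_outer : measurable D.
Proof.
rewrite (_ : D = `]-oo, (- eps)] `|` `[eps, +oo[); first exact: measurableU.
apply/seteqP; split=> r; rewrite /outer /mkset /setU /mkset !(@in_itv _ R) /= andbT ler_normr.
  by move=> /orP[h|h]; [right|left; lra].
by move=> [h|h]; apply/orP; [right; lra|left].
Qed.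

Let mD := measurable_outer.

Lemma loc_int_inv g y : dom H g -> H g = E D y -> E D g = g ->
  loc_int E D (fun w => w^-1) y g.
Proof.
move=> Hg Hgy gD a b e e0.
have ie : 0 <= eps^-1 by rewrite invr_ge0 ltW.
have [eta eta0 he] := small_mesh e0 ie (nm_ge0 g).
exists eta => // n A t pt; have [p1 p2 p3 p4 p5] := pt.
rewrite nmE ltcR; apply: le_lt_trans he.
have AD i r : A i r -> D r.
  by move=> Air; have : (\bigcup_i A i) r; [exists i|rewrite p3 => -[]].
have tD i : eps <= `|t i| by exact: (AD i _ (p4 i)).
have t0 i : t i != 0 by rewrite -normr_gt0; apply: lt_le_trans (tD i).
have := pvm_riemann_sum (phi := fun w => w^-1) Hg pt eta0 ie.
move=> h; apply: le_trans (h _); last first.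
  by move=> i; rewrite normfV lef_pV2 ?posrE // (lt_le_trans _ (tD i)).
rewrite le_eqVlt; apply/orP; left; apply/eqP; congr nm.
under [in RHS]eq_bigr => i _.
  rewrite (pvmB hE (p1 _)) (pvmZ hE (p1 _)) scalerBr scalerA -rmorphM /= mulVf // scale1r.
  rewrite Hgy (pvm_sub hdot hE _ (p1 i) mD (AD i)).1.
  over.
by rewrite sumrB (pvm_bigcup hE) // p3.
Qed.

Hypothesis H_gap : spectrum H `<=`
  [set t%:C%C | t in [set t : R | [\/ t <= - eps, t = 0 | eps <= t]]].

Lemma pvm_ext A : measurable A -> (forall g, dom H g -> E A g = 0) -> forall x, E A x = 0.
Proof.
move=> mA h x; apply: nm_small => e e0; have [g Hg xg] := sa_dense H_sa x e0.
apply: ltW; apply: le_lt_trans xg; rewrite -[E A x]subr0 -(h g Hg) -(pvmB hE mA).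
exact: pvm_le.
Qed.

(** If [M] bounds the resolvent at [mu], the radius [1 / (2 M)] gives [|v| <= |v| / 2] for
    [v = E A g]. *)
Lemma pvm_locally_null (mu : R) : `|mu| < eps -> mu != 0 -> exists2 eta : R, 0 < eta &
  forall A, measurable A -> (forall r, A r -> `|r - mu| <= eta) -> forall x, E A x = 0.
Proof.
move=> mue mu0.
have : resolvent_set H mu%:C%C.
  apply: contrapT => /H_gap[s hs /complexI smu]; subst s.
  move: mue; rewrite ltr_norml => /andP[m1 m2].
  by case: hs => [?|/eqP|?]; [lra|rewrite (negbTE mu0)|lra].
move=> /resolvent_bound[M M0 hM].
exists (M^-1 / 2); first by rewrite divr_gt0 // invr_gt0.
move=> A mA Amu; apply: pvm_ext => // g Hg; apply/nm_eq0.
have [HA HE] := pvm_reduces mA Hg.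
have h1 := hM _ HA; rewrite HE -(pvmZ hE mA) -(pvmB hE mA) in h1.
have h2 : nm (E A (H g - mu%:C%C *: g)) <= M^-1 / 2 * nm (E A g).
  by apply: pvm_localizes => //; rewrite divr_ge0 // invr_ge0 ltW.
have h3 : M * nm (E A (H g - mu%:C%C *: g)) <= M * (M^-1 / 2 * nm (E A g)) by rewrite ler_pM2l.
have h4 : M * (M^-1 / 2 * nm (E A g)) = nm (E A g) / 2 by field; lra.
have := nm_ge0 (E A g); lra.
Qed.

Definition gap : set R := ~` D `&` ~` [set 0].

Lemma measurable_gap : measurable gap.
Proof. by apply: measurableI; apply: measurableC => //; exact: measurable_set1. Qed.

(** The local result must be made countable: intervals with rational endpoints on which [E] vanishes
    are enumerated by [unpickle] and cover the gap. *)
Lemma pvm_gap x : E gap x = 0.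
Proof.
pose I (q : rat * rat) : set R := [set` `](ratr q.1 : R), (ratr q.2 : R)[%R].
pose F (n : nat) : set R := if unpickle n is Some q then
  if `[< forall x, E (I q) x = 0 >] then I q else set0 else set0.
have mF n : measurable (F n).
  rewrite /F; case: unpickle => [q|]; last exact: measurable0.
  by case: asboolP => _; [exact: measurable_itv|exact: measurable0].
have F0 n y : E (F n) y = 0.
  rewrite /F; case: unpickle => [q|]; last exact: (pvm_set0 hE).
  by case: asboolP => // _; exact: (pvm_set0 hE).
have gF : gap `<=` \bigcup_n F n.
  move=> mu [/negP nD mu0]; rewrite -ltNge in nD.
  have [|eta eta0 h] := pvm_locally_null nD; first exact/eqP.
  have [p] : exists p, ratr p \in `]mu - eta, mu[ by apply: rat_in_itvoo; lra.
  have [q] : exists q, ratr q \in `]mu, mu + eta[ by apply: rat_in_itvoo; lra.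
  rewrite !in_itv /= => /andP[q1 q2] /andP[p1 p2].
  exists (pickle (p, q)); first exact: Logic.I.
  rewrite /F pickleK.
  have -> : `[< forall x, E (I (p, q)) x = 0 >].
    apply/asboolP => y; apply: h; first exact: measurable_itv.
    move=> r; rewrite /I /mkset (@in_itv _ R) /= => /andP[r1 r2].
    by rewrite ler_norml; apply/andP; split; lra.
  by rewrite /I /mkset (@in_itv _ R) /= p2.
have mU : measurable (\bigcup_n F n) by exact: bigcupT_measurable.
rewrite -(pvm_sub hdot hE x measurable_gap mU gF).1 (pvm_null hdot hE) //.
by rewrite (pvm0 hE) //; exact: measurable_gap.
Qed.

Lemma pvm_gap_split x : x = E [set 0] x + E D x.
Proof.
have m0 : measurable [set (0 : R)] by exact: measurable_set1.
rewrite -{1}(pvmT hE x) (pvm_split hE x measurableT mD) setTI setTD.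
rewrite (pvm_split hE x (measurableC mD) m0) (_ : ~` D `&` [set 0] = [set 0]).
  by rewrite setDE -/gap pvm_gap addr0 addrC.
apply/seteqP; split=> [r []//|_ ->]; split=> //.
by rewrite /outer /= normr0 => h; move: eps_gt0; lra.
Qed.

Lemma pvm_ker0 x : op_ker H (E [set 0] x).
Proof.
have m0 : measurable [set (0 : R)] by exact: measurable_set1.
have H0 g : dom H g -> op_ker H (E [set 0] g).
  move=> Hg; have [H1 H2] := pvm_reduces m0 Hg; split=> //; rewrite H2.
  have : nm (E [set 0] (H g - (0 : R)%:C%C *: g)) <= 0 * nm (E [set 0] g).
    by apply: pvm_localizes => // r ->; rewrite subrr normr0.
  rewrite scale0r subr0 mul0r => h; apply/nm_eq0/eqP.
  by rewrite eq_le h nm_ge0.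
apply: (ker_closed hdot H_sa) => e e0; have [g Hg xg] := sa_dense H_sa x e0.
exists (E [set 0] g); first exact: H0.
by apply: le_lt_trans xg; rewrite -(pvmB hE m0); exact: pvm_le.
Qed.

(** The Riemann sum [s] has norm at least [eps] times that of its undamped version, because all tags
    lie in [D]. In [key], [e * nm g] is the Riemann error and [e * eps] the truncation error. *)
Lemma pvm_outer_bound g : dom H g -> eps * nm (E D g) <= nm (E D (H g)).
Proof.
move=> Hg.
suff key (e : R) : 0 < e -> eps * nm (E D g) <= nm (E D (H g)) + e * (nm g + eps).
  apply/ler_addgt0Pr.
  change (forall e : R, 0 < e -> eps * nm (E D g) <= nm (E D (H g)) + e) => e e0.
  have g0 := nm_ge0 g.
  have ge : 0 < nm g + eps by rewrite ltr_wpDl.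
  have := key (e / (nm g + eps)); rewrite divfK; last exact: lt0r_neq0.
  by apply; rewrite divr_gt0.
move=> e0; have [N hN] := pvm_exhaust hdot hE g mD e0.
have h1 := hN (- N) N (lexx _) (lexx _).
have mN := measurable_Icc (- N) N mD.
have [n [A [t pt]]] := tagged_partition_exists mN e0 (@subIsetr _ _ _).
have [p1 p2 p3 p4 p5] := pt.
have AD i r : A i r -> D r.
  by move=> Air; have : (\bigcup_i A i) r; [exists i|rewrite p3 => -[]].
have h2 := pvm_riemann_sum (c := 1) (phi := fun=> 1) Hg pt e0 ler01.
rewrite normr1 in h2; have {}h2 := h2 (fun=> lexx _).
pose s := \sum_(i < n) E (A i) ((t i)%:C%C *: g).
have {}h2 : nm (E (D `&` `[(- N), N]) (H g) - s) <= 1 * e * nm g.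
  move: h2; congr (nm _ <= _); under eq_bigr do rewrite scale1r (pvmB hE (p1 _)).
  by rewrite sumrB (pvm_bigcup hE) // p3.
have h3 : eps * nm (E (D `&` `[(- N), N]) g) <= nm s.
  rewrite -(ler_pXn2r (n := 2)) ?nnegrE ?mulr_ge0 ?nm_ge0 ?(ltW eps_gt0) //.
  rewrite /s (pvm_pythagoras hdot hE) // exprMn -p3 -(pvm_bigcup hE) //.
  rewrite (pvm_pythagoras hdot hE) // mulr_sumr; apply: ler_sum => i _.
  rewrite (pvmZ hE (p1 i)) nmZ exprMn ler_wpM2r ?sqr_ge0 //.
  rewrite ler_pXn2r ?nnegrE ?(ltW eps_gt0) //; exact: (AD i _ (p4 i)).
have h4 : nm (E (D `&` `[(- N), N]) (H g)) <= nm (E D (H g)).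
  by apply: pvm_mono => // r [].
have := nm_tri (E (D `&` `[(- N), N]) g) (E D g) 0; rewrite !subr0 => h5.
have := nm_tri (E (D `&` `[(- N), N]) (H g)) s 0; rewrite !subr0 (nmBC s) => h6.
have h7 : eps * nm (E D g) <= eps * (e + nm (E (D `&` `[(- N), N]) g)).
  by rewrite ler_pM2l //; lra.
lra.
Qed.

Lemma ker_pvm0 g : op_ker H g -> E D g = 0.
Proof.
move=> [Hg g0]; have := pvm_outer_bound Hg; rewrite g0 (pvm0 hE mD) nm0 => h.
have := nm_ge0 (E D g); have := eps_gt0 => e0 h'; apply: nm_eq0; nra.
Qed.

Lemma perp_pvm y : perp (op_ker H) y -> E D y = y.
Proof.
move=> py; rewrite [RHS](pvm_gap_split y).
suff -> : E [set 0] y = 0 by rewrite add0r.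
apply/nm_eq0/eqP; rewrite -sqrf_eq0 (pvm_sqr hdot hE) // rdC py //.
exact: pvm_ker0.
Qed.

Lemma outer_perp y : perp (op_ker H) (E D y).
Proof.
by move=> k kk; rewrite (pvm_sym hE) // ker_pvm0 // rd0r.
Qed.

(** On the complement of its kernel [H] is bounded below by [eps], so [closed_range] solves
    [H g = E D y]; applying [E D] then normalizes [g]. *)
Lemma outer_inverse y : exists g, [/\ dom H g, H g = E D y & E D g = g].
Proof.
have hc g : dom H g -> perp (op_ker H) g -> eps * nm g <= nm (H g).
  move=> Hg pg; have := pvm_outer_bound Hg; rewrite (perp_pvm pg).
  by move=> h; apply: le_trans h _; exact: pvm_le.
have : op_range H (E D y) by rewrite (closed_range hdot H_sa eps_gt0 hc); exact: outer_perp.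
move=> [g Hg Hgy]; have [H1 H2] := pvm_reduces mD Hg.
by exists (E D g); split; rewrite // ?H2 ?Hgy ?idE.
Qed.

End spectral_families.

Section linear_maps.
Variables (R : realType) (X : completeNormedModType R[i]).
Variable f : X -> X.
Hypothesis lf : linear f.

Lemma linear_mapZ a x : f (a *: x) = a *: f x.
Proof. by have := lf a x 0; rewrite (linear_map0 lf) !addr0. Qed.

Lemma linear_mapD x y : f (x + y) = f x + f y.
Proof. by have := lf 1 x y; rewrite !scale1r. Qed.

End linear_maps.

Lemma skew_of_adjoint (R : realType) (X : completeNormedModType R[i])
    (dot : {dot X for Num.conj}) (J : X -> X) :
  op_eq (adjoint dot (everywhere J)) (everywhere (fun x => - J x)) ->
  forall x y, dot (J x) y = - dot x (J y).
Proof.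
move=> [ad aE] x y; have ay : dom (adjoint dot (everywhere J)) y by rewrite ad.
have [z hz] := ay.
have h := xgetPex 0 (ex_intro
  (fun z => forall x, dom (everywhere J) x -> dot (J x) y = dot x z) z hz).
have : dot (J x) y = dot x (adjoint dot (everywhere J) y) by exact: h.
by rewrite (aE _ ay) /= => ->; exact: linearNr.
Qed.

(** * The decomposition *)

Section decomposition.
Variables (R : realType) (X : completeNormedModType R[i]).
Variable dot : {dot X for Num.conj}.
Hypothesis hdot : dot_induces_norm dot.
Variable J : {linear X -> X}.
Hypothesis J_skew : forall x y, dot (J x) y = - dot x (J y).
Variable L : operator X.
Hypothesis L_sa : selfadjoint dot L.
Hypothesis L_ran : op_range L = perp dot (op_ker L).
Hypothesis L_low : exists2 c : R, 0 < c &
  forall x, dom L x -> perp dot (op_ker L) x -> c * nm x <= nm (L x).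
Hypothesis K_fin : finite_dimensional (op_ker L).
Hypothesis JK : J @` op_ker L `<=` dom L.
Local Notation H := (H_op J L).
Hypothesis H_sa : selfadjoint dot H.
Variables (eps : R) (eps_gt0 : 0 < eps).
Hypothesis H_gap : spectrum H `<=`
    [set t%:C%C | t in [set t : R | [\/ t <= - eps, t = 0 | eps <= t]]].
Variable E : set R -> X -> X.
Hypothesis E_H : spectral_family dot H E.
Local Notation D := (outer eps).
Local Notation P := (P_op dot J L).
Local Notation Pi0 := (Pi_0 dot J L).
Local Notation PiK := (Pi_K dot L).
Implicit Types x y z v : X.

Let hE : projection_measure dot E. Proof. by case: E_H. Qed.
Let mD : measurable D := measurable_outer eps.
Let kL := ker_linsub L_sa.
Let kcL := ker_closed hdot L_sa.

Lemma ker_sub x : op_ker L x -> op_ker H x.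
Proof.
move=> [Lx x0]; split; last by rewrite /= x0 !linear0 ?scaler0 (sa0 L_sa).
by split=> //; rewrite x0 linear0; exact: (sa_dom L_sa).1.
Qed.

Lemma perp_kerH_range v : perp dot (op_ker H) v -> op_range L v.
Proof. by move=> pv; rewrite L_ran => k /ker_sub; exact: pv. Qed.

(** Makes [Lplus_inv] meaningful on each cell of a Riemann sum over [D]. *)
Lemma outer_range A y : measurable A -> A `<=` D -> op_range L (E A y).
Proof.
move=> mA AD; rewrite -(pvm_sub hdot hE y mA mD AD).2; apply: perp_kerH_range.
exact: outer_perp.
Qed.

Lemma linP : linear P.
Proof. by have [M _ []] := P_opP hdot L_sa J_skew K_fin JK. Qed.

Lemma P_ker v : op_ker L (P v).
Proof. by have [M _ []] := P_opP hdot L_sa J_skew K_fin JK. Qed.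

Lemma P_dom v : dom L v -> P v = PiK (J (L v)).
Proof. by have [M _ [_ _ _ h]] := P_opP hdot L_sa J_skew K_fin JK; exact: h. Qed.

Lemma Linv_bop : bounded_op (Linv dot L).
Proof.
split; first exact: Linv_linear.
have [c c0 hc] := L_low; exists c^-1; first by rewrite invr_gt0.
exact: Linv_bounded hc.
Qed.

Lemma iP_bop : bounded_op (fun v => 'i%C *: P v).
Proof.
split; first by move=> a x y; rewrite linP scalerDr !scalerA mulrC.
have [M M0 [_ _ b _]] := P_opP hdot L_sa J_skew K_fin JK.
by exists M => // v; rewrite nmZi.
Qed.

Lemma outer_neq0 w : D w -> w != 0.
Proof.
move=> Dw; rewrite -normr_gt0; exact: lt_le_trans Dw.
Qed.

Section fixed_vector.
Variables (y g : X).
Hypothesis Hy : dom H y.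
Hypotheses (Hg : dom H g) (Hgy : H g = E D y) (gD : E D g = g).

Let loc_inv : loc_int E D (fun w => w^-1) y g.
Proof. exact: (loc_int_inv hdot E_H eps_gt0 Hg Hgy gD). Qed.

(** Leaving [k] free off [D] and off the range of [L] covers both the kernel in [X_eps] and the one
    in [dF] carrying the factor [phi = 1]. *)
Lemma sint_kernel (k : R -> X -> X) :
  (forall w v, D w -> op_range L v ->
    k w v = Lplus_inv L v + ('i%C / w%:C%C) *: P v) ->
  is_sint E D k y (Linv dot L (E D y) + 'i%C *: P g).
Proof.
move=> hk; rewrite -gD.
apply: (sint_intro hdot hE mD Linv_bop iP_bop (loc_int1 hE y mD) loc_inv).
move=> w A Dw mA AD; have rA := outer_range y mA AD.
by rewrite hk // scale1r (LinvE hdot L_sa L_ran rA) (linear_mapZ linP) scalerA fmorphV.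
Qed.

Lemma sint_kernel_id (k : R -> X -> X) :
  (forall w v, D w -> op_range L v ->
    k w v = w%:C%C *: Lplus_inv L v + 'i%C *: P v) ->
  is_sint E D k y (Linv dot L (E D (H y)) + 'i%C *: P (E D y)).
Proof.
move=> hk.
apply: (sint_intro hdot hE mD Linv_bop iP_bop (loc_int_id hdot E_H mD Hy) (loc_int1 hE y mD)).
move=> w A Dw mA AD; have rA := outer_range y mA AD.
by rewrite hk // scale1r (linear_mapZ Linv_bop.1) (LinvE hdot L_sa L_ran rA).
Qed.

Lemma sint_inv : is_sint E D (fun w v => (w%:C%C)^-1 *: v) y g.
Proof.
have bid : bounded_op (@id X) by split=> //; exists 1 => // x; rewrite mul1r.
have b0 : bounded_op (fun _ : X => 0).
  split; first by move=> a u v /=; rewrite scaler0 addr0.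
  by exists 1 => // x; rewrite nm0 mul1r nm_ge0.
rewrite -gD -[E D g]addr0.
apply: (sint_intro hdot hE mD bid b0 loc_inv (loc_int1 hE y mD)) => w A Dw mA AD.
by rewrite addr0 fmorphV.
Qed.

End fixed_vector.

(** [E [set 0] y] remains orthogonal to [op_ker L]: [E [set 0]] is symmetric and fixes [op_ker H],
    which contains [op_ker L], and [y] is orthogonal to it. *)
Lemma Pi0E y : op_range L y -> Pi0 y = E [set 0] y.
Proof.
move=> Ry; have m0 : measurable [set (0 : R)] by exact: measurable_set1.
have k0 := pvm_ker0 hdot H_sa E_H y.
have kH := ker_linsub H_sa.
have split0 k : op_ker H k -> E [set 0] k = k.
  move=> kk; rewrite [RHS](pvm_gap_split hdot H_sa E_H eps_gt0 H_gap k).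
  by rewrite (ker_pvm0 hdot E_H eps_gt0 kk) addr0.
rewrite /Pi_0; apply: oproj_eq => //.
- rewrite L_ran; have pL := perp_linsub dot kL.
  split=> [|a u v [u1 u2] [v1 v2]]; first by split; [exact: kH.1|exact: pL.1].
  by split; [exact: kH.2|exact: pL.2].
- split=> //; rewrite L_ran => k kk; rewrite (pvm_sym hE) // split0; last exact: ker_sub.
  by move: Ry; rewrite L_ran; apply.
- move=> k [kk _].
  rewrite -{1}(split0 k kk) -(pvm_sym hE) // (pvmB hE m0) (pvm_idem hE) // subrr.
  exact: rd0l.
Qed.

(* [Linv (H v) = i (1 - Pi_K) J L v], so that the two parts of the integral of
   [w dF] recombine to [J L v]. *)
Lemma Linv_H v : dom H v -> - ('i%C *: (Linv dot L (H v) + 'i%C *: P v)) = J (L v).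
Proof.
move=> [Lv LJLv]; have Li : dom L ('i%C *: J (L v)) by exact: (linsubZ (sa_dom L_sa)).
have RH : op_range L (H v) by exists ('i%C *: J (L v)).
rewrite (LinvE hdot L_sa L_ran RH) (Lplus_invK hdot L_sa L_ran Li) P_dom //.
rewrite /Pi_K (linear_mapZ (oproj_linear hdot kL kcL)) subrK scalerA.
have -> : 'i%C * 'i%C = -1 :> R[i] by rewrite -expr2 sqr_i.
by rewrite scaleN1r opprK.
Qed.

End decomposition.

Theorem lemma3p3 (R : realType) (X : completeNormedModType R[i])
  (dot : {dot X for Num.conj}) (hdot : dot_induces_norm dot)
  (J : {linear X -> X}) (J_bounded : continuous J)
  (J_adj : op_eq (adjoint dot (everywhere J)) (everywhere (fun x => - J x)))
  (J_sq : forall x, J (J x) = - x)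
  (B : operator X) (B_sa : selfadjoint dot B) (B_ge0 : nonneg_op dot B)
  (L : operator X) (L_sqrt : is_sqrt_op dot B L)
  (hI : exists2 d : R, 0 < d &
    spectrum B `<=` [set t%:C%C | t in [set t : R | t = 0 \/ d <= t]])
  (hII : finite_dimensional (op_ker B))
  (hIII : J @` op_ker L `<=` dom L)
  (hIV : selfadjoint dot (H_op J L))
  (eps : R) (eps_gt0 : 0 < eps)
  (H_gap : spectrum (H_op J L) `<=`
    [set t%:C%C | t in [set t : R | [\/ t <= - eps, t = 0 | eps <= t]]])
  (E : set R -> X -> X) (E_H : spectral_family dot (H_op J L) E)
  (x : X) (hx : W_space J L x) :
  let A := A_op J B in
  let P := P_op dot J L in
  let Pi0 := Pi_0 dot J L in
  let D := outer eps in
  let dF := dF dot J L E eps in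
  let dF_defined := dF_defined dot J L E eps in
  let k := fun (w : R) (v : X) => Lplus_inv L v + ('i%C / w%:C%C) *: P v in
  let k' := fun (w : R) (v : X) => w%:C%C *: Lplus_inv L v + 'i%C *: P v in
  let xe := sint E D k (L x) in
  let x0 := Pi_K dot L x
            - 'i%C *: P (sint E D (fun w v => (w%:C%C)^-1 *: v) (L x)) in
  let xa := Lplus_inv L (Pi0 (L x)) in
  [/\ dF_defined (fun=> 1) x, dF_defined (fun w => w) x,
      ex_sint E D k (L x) & ex_sint E D k' (L x)] /\
  (x = dF (fun=> 1) x /\ dF (fun=> 1) x = xe + x0 + xa) /\
  [/\ dom A x, dom A xe, dom A x0 & dom A xa] /\
  (A x = - ('i%C *: dF (fun w => w) x) /\
   - ('i%C *: dF (fun w => w) x) = A xe + A x0 + A xa) /\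
  [/\ A xe = - ('i%C *: sint E D k' (L x)), A x0 = 0 & A xa = P (Pi0 (L x))].
Proof.
have [d d0 hd] := hI; have l0 : 0 < d / 2 by rewrite divr_gt0.
have {}hd : spectrum B `<=` [set t%:C%C | t in [set t : R | t = 0 \/ 2 * (d / 2) <= t]].
  by have -> : 2 * (d / 2) = d by rewrite mulrC divfK.
have L_sa := sqrt_sa L_sqrt; have kBL := ker_sqrt hdot L_sqrt.
have L_ran := sqrt_range hdot B_sa B_ge0 L_sqrt l0 hd.
have L_low := sqrt_lower_bound hdot B_sa B_ge0 L_sqrt l0 hd.
have J_skew := skew_of_adjoint J_adj.
rewrite kBL in hII.
have hE : projection_measure dot E by case: E_H.
have mD : measurable (outer eps) by exact: measurable_outer.
have [Lx Hy] := hx; set y := L x in Hy *.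
have [g [Hg Hgy gD]] := outer_inverse hdot hIV E_H eps_gt0 H_gap y.
pose li := Linv dot L; have lli : linear li by exact: (Linv_bop hdot L_sa L_ran L_low).1.
have lP := linP hdot J_skew L_sa hII hIII.
have kP := P_ker hdot J_skew L_sa hII hIII.
have sk := sint_kernel hdot J_skew L_sa L_ran L_low hII hIII eps_gt0 E_H Hg Hgy gD.
have sk' := sint_kernel_id hdot J_skew L_sa L_ran L_low hII hIII eps_gt0 E_H Hy.
have sinv := sint_inv hdot eps_gt0 E_H Hg Hgy gD.
have Ry : op_range L y by exists x.
have p0 := Pi0E hdot L_sa L_ran hIV eps_gt0 H_gap E_H Ry.
move=> A P Pi0 D dF dF_defined k k' xe x0 xa.
have sxe : is_sint E D k y (li (E D y) + 'i%C *: P g) by apply: sk.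
have sxe' : is_sint E D k' y (li (E D (H_op J L y)) + 'i%C *: P (E D y)) by apply: sk'.
have sF1 : is_sint E D (fun w v => ((fun=> 1) w)%:C%C *: dF_kernel dot J L w v) y
    (li (E D y) + 'i%C *: P g).
  by apply: sk => w v Dw Rv; rewrite scale1r.
have sFid : is_sint E D (fun w v => w%:C%C *: dF_kernel dot J L w v) y
    (li (E D (H_op J L y)) + 'i%C *: P (E D y)).
  (* Multiplication by [w] cancels the denominator, as [w] is nonzero on [D]. *)
  apply: sk' => w v Dw Rv; rewrite /dF_kernel scalerDr scalerA mulrCA mulfV ?mulr1 //.
  by apply/eqP => /complexI/eqP; rewrite (negbTE (outer_neq0 eps_gt0 Dw)).
have xeE : xe = li (E D y) + 'i%C *: P g by exact: sint_eq sxe.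
have gE : sint E D (fun w v => (w%:C%C)^-1 *: v) y = g by exact: sint_eq sinv.
have x0E : x0 = Pi_K dot L x - 'i%C *: P g by rewrite /x0 gE.
have ysplit := pvm_gap_split hdot hIV E_H eps_gt0 H_gap y.
have k0 := pvm_ker0 hdot hIV E_H y.
have R0 : op_range L (E [set 0] y).
  have -> : E [set 0] y = y - E D y by rewrite {2}ysplit addrK.
  rewrite L_ran; apply: (linsubB (perp_linsub dot (ker_linsub L_sa))); rewrite -L_ran //.
  exact: (outer_range hdot L_sa L_ran eps_gt0 E_H y mD).
have RD : op_range L (E D y) by exact: (outer_range hdot L_sa L_ran eps_gt0 E_H y mD).
have xaE : xa = li (E [set 0] y) by rewrite /xa /Pi0 p0 /li (LinvE hdot L_sa L_ran R0).
have xsum : xe + x0 + xa = x.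
  have : li y = x - Pi_K dot L x.
    by rewrite /li (LinvE hdot L_sa L_ran Ry) (Lplus_invK hdot L_sa L_ran Lx).
  rewrite {1}ysplit (linear_mapD lli) xeE x0E xaE => h.
  by rewrite [Pi_K dot L x - _]addrC addrA addrK addrAC [li (E D y) + _]addrC h subrK.
have d1 : derive1 (fun=> 1 : R) 0 = 0 :> R by rewrite derive1_cst.
have d2 : derive1 (fun w : R => w) 0 = 1 :> R by rewrite derive1E derive_id.
have F1 : dF (fun=> 1) x = xe + x0 + xa.
  rewrite /dF /Defs.dF (sint_eq mD sF1) /delta /delta' d1 !scale1r -xeE /xa oppr0 scale0r subr0.
  by [].
(* For [phi w = w] both [delta] terms vanish, while [phi' 0 = 1] makes [delta' phi = -1], so the
   last term enters with a plus sign. *)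
have Fid : dF (fun w => w) x = li (E D (H_op J L y)) + 'i%C *: P (E D y)
    + 'i%C *: P (E [set 0] y).
  rewrite /dF /Defs.dF (sint_eq mD sFid) /delta /delta' d2 !scale0r !addr0 -/Pi0 /Pi0 p0.
  by rewrite rmorphN scaleN1r opprK.
have [HD HDE] := pvm_reduces hdot E_H mD Hy.
have LinvH := Linv_H hdot J_skew L_sa L_ran hII hIII.
have [dle lle] : dom L (li (E D y)) /\ L (li (E D y)) = E D y.
  by rewrite /li (LinvE hdot L_sa L_ran RD); have [] := Lplus_invP hdot L_sa L_ran RD.
have [dl0 ll0] : dom L (li (E [set 0] y)) /\ L (li (E [set 0] y)) = E [set 0] y.
  by rewrite /li (LinvE hdot L_sa L_ran R0); have [] := Lplus_invP hdot L_sa L_ran R0.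
(* The values of [P] lie in the kernel, which is also that of [B]; hence [A x0 = 0]. *)
have kLx : op_ker L x0.
  rewrite x0E; apply: (linsubB (ker_linsub L_sa)).
    exact: (oproj_in hdot (ker_linsub L_sa) (ker_closed hdot L_sa)).
  by apply: (linsubZ (ker_linsub L_sa)); exact: kP.
have [Bx0 Bx00] : op_ker B x0 by rewrite kBL.
have kLg : op_ker L ('i%C *: P g) by apply: (linsubZ (ker_linsub L_sa)); exact: kP.
have Lxe : dom L xe by rewrite xeE; apply: (linsubD (sa_dom L_sa)) => //; case: kLg.
have LxeE : L xe = E D y.
  by rewrite xeE (saD L_sa) // ?lle; [case: kLg => _ ->; rewrite addr0|case: kLg].
have Bx : dom B x by apply/(sqrtE L_sqrt); split=> //; case: Hy.
have Bxe : dom B xe by apply/(sqrtE L_sqrt); split=> //; rewrite LxeE; case: HD.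
have Bxa : dom B xa.
  by apply/(sqrtE L_sqrt); rewrite xaE ll0; split=> //; case: k0 => -[].
(* [Linv_H] at [E D y], using that [H] commutes with [E D]. *)
have Axe : A xe = - ('i%C *: sint E D k' y).
  rewrite (sint_eq mD sxe') -HDE (LinvH _ HD) /A /A_op /=.
  by rewrite -(sqrtB L_sqrt) // LxeE.
have Ax0 : A x0 = 0 by rewrite /A /A_op /= Bx00 linear0.
(* [Linv_H] at [E [set 0] y], where [H] vanishes and only the [P] term survives. *)
have Axa : A xa = P (Pi0 y).
  rewrite /A /A_op /= -(sqrtB L_sqrt) // xaE ll0 /Pi0 p0.
  have [H0 H00] := k0; rewrite -(LinvH _ H0) H00.
  rewrite -/li (linear_map0 lli) add0r scalerA.
  have -> : 'i%C * 'i%C = -1 :> R[i] by rewrite -expr2 sqr_i.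
  by rewrite scaleN1r opprK.
have Fsum : - ('i%C *: dF (fun w => w) x) = A xe + A x0 + A xa.
  rewrite Axe Ax0 addr0 Axa (sint_eq mD sxe') Fid scalerDr opprD /Pi0 p0; congr (_ + _).
  rewrite scalerA.
  have -> : 'i%C * 'i%C = -1 :> R[i] by rewrite -expr2 sqr_i.
  by rewrite scaleN1r opprK.
split; first split.
- by split; [exists (li (E D y) + 'i%C *: P g)|exists g].
- split; last by exists g.
  by exists (li (E D (H_op J L y)) + 'i%C *: P (E D y)).
- by exists (li (E D y) + 'i%C *: P g).
- by exists (li (E D (H_op J L y)) + 'i%C *: P (E D y)).
split; first by rewrite F1 xsum.
split; first by split.
split; last by split.
split=> //; rewrite Fsum -{1}xsum /A /A_op /=.
have Be0 := linsubD (sa_dom B_sa) Bxe Bx0.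
by rewrite (saD B_sa Be0 Bxa) (saD B_sa Bxe Bx0) !linearD.
Qed.
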